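(* Fix integers $c\ge 2$ and $r\ge 3$, let $\bm a=(a_1,\dots,a_r)\in\{1,\dots,c-1\}^r$ be an admissible $r$-palette, and let $\theta_1,\dots,\theta_{c-1}>0$ be such that $\sum_{b\in S(\bm a)}w_b\theta_b<2$ and $\theta_{\max}=1$. Then, as $n\to\infty$, $$\frac{X_{r,n}(\bm a)}{n^{2-\sum_{b\in S(\bm a)}w_b\theta_b}}\xrightarrow{D}\sum_{x\in\mathcal P}\lambda_{\bm a}(x),$$ where $\mathcal P$ is a Poisson point process of rate $1$ on $[0,1]$.
   Context: Notation: $[n]=\{1,\dots,n\}$. An $r$-AP in $[n]$ is an ordered tuple $\bm x=(x,x+d,\dots,x+(r-1)d)$ with $d\ge 1$ an integer and all entries in $[n]$. An $r$-palette is an ordered sequence $\bm a=(a_1,\dots,a_r)\in[c]^r$; it is admissible if $\bm a\in[c-1]^r$. Given a coloring $\phi_n:[n]\to[c]$, an $r$-AP is $\bm a$-colorful if $\phi_n(x+(s-1)d)=a_s$ for every $s\in[r]$. Random coloring: with fixed $\theta_1,\dots,\theta_{c-1}>0$ and $n$ large, each element of $[n]$ is independently assigned color $b\in[c]$ with probability $p_b$, where $p_b=n^{-\theta_b}$ for $b\in[c-1]$ and $p_c=1-\sum_{b=1}^{c-1}p_b$. $X_{r,n}(\bm a)$ is the number of $\bm a$-colorful $r$-APs in $[n]$ under this random coloring. $S(\bm a)$ is the set of distinct colors appearing in $\bm a$, $w_b$ is the number of times color $b\in S(\bm a)$ appears in $\bm a$, and $\theta_{\max}=\max_{b\in S(\bm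 a)}\theta_b$. When $\sum_{b\in S(\bm a)}w_b\theta_b<2$ and $\theta_{\max}=1$ there is a unique index $\hat s\in[r]$ (the rare coordinate) with $\theta_{a_{\hat s}}=1$. The function $\lambda_{\bm a}:[0,1]\to[0,\infty)$ is $$\lambda_{\bm a}(x)=\min\left\{\frac{x}{\hat s-1},\frac{1-x}{r-\hat s}\right\},$$ where, if one of the two terms has zero denominator (i.e. $\hat s=1$ or $\hat s=r$), $\lambda_{\bm a}(x)$ is defined to be the other term. *)

(* Defs.v *)
From HB Require Import structures.
From mathcomp Require Import all_boot all_order all_algebra finmap.
From mathcomp Require Import all_classical all_reals all_analysis.

Set Implicit Arguments.
Unset Strict Implicit.
Unset Printing Implicit Defensive.

Import Order.TTheory GRing.Theory Num.Theory.
Import numFieldNormedType.Exports.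

Local Open Scope ring_scope.

(* Conventions.  The integer i + 1 of [n] is encoded by i : 'I_n and, likewise,
   the color b + 1 of [c] by b : 'I_c; the special color c is thus the largest
   element of 'I_c, and the colors in [c - 1] are the elements of 'I_c.-1.
   An r-palette has type {ffun 'I_r -> 'I_c}; the admissible ones are given as
   elements of {ffun 'I_r -> 'I_c.-1}, embedded by [palette_of]. *)

Definition palette_of (c r : nat) (a : {ffun 'I_r -> 'I_c.-1}) :
  {ffun 'I_r -> 'I_c} := [ffun s => widen_ord (leq_pred c) (a s)].

(* Being an arithmetic progression is invariant under the shift by 1 of the
   encoding of [n] by 'I_n. *)
Definition is_AP (r n : nat) (t : {ffun 'I_r -> 'I_n}) : bool :=
  [exists x : 'I_n, [exists d : 'I_n.+1,
    (0 < d)%N && [forall s : 'I_r, (t s : nat) == (x + s * d)%N]]].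

Definition colorful (c r n : nat) (phi : {ffun 'I_n -> 'I_c})
    (a : {ffun 'I_r -> 'I_c}) (t : {ffun 'I_r -> 'I_n}) : bool :=
  [forall s : 'I_r, phi (t s) == a s].

Definition num_colorful_AP (c r n : nat) (phi : {ffun 'I_n -> 'I_c})
    (a : {ffun 'I_r -> 'I_c}) : nat :=
  #|[set t : {ffun 'I_r -> 'I_n} | is_AP t && colorful phi a t]|.

Definition palette_set (c r : nat) (a : {ffun 'I_r -> 'I_c.-1}) :
  {set 'I_c.-1} := [set a s | s : 'I_r].

Definition weight (c r : nat) (a : {ffun 'I_r -> 'I_c.-1}) (b : 'I_c.-1) : nat :=
  #|[set s : 'I_r | a s == b]|.

Section Palette.
Variables (R : realType) (c r : nat).
Variables (theta : 'I_c.-1 -> R) (a : {ffun 'I_r -> 'I_c.-1}).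

Definition weighted_theta : R :=
  \sum_(b in palette_set a) (weight a b)%:R * theta b.

(* The default value 0 is harmless as the theta_b are positive. *)
Definition theta_max : R := \big[Num.max/0]_(b in palette_set a) theta b.

(* The rare coordinate, in {1, ..., r}: the position of the only s such that
   theta_(a_s) = 1; see [rare_coordinateP]. *)
Definition rare_coordinate : nat :=
  (find (fun s => theta (a s) == 1) (enum 'I_r)).+1.

Lemma weighted_thetaE : weighted_theta = \sum_(s < r) theta (a s).
Proof.
rewrite /weighted_theta (partition_big a (mem (palette_set a))) /=; last first.
  by move=> s _; apply/imsetP; exists s.
apply: eq_bigr => b _; rewrite (eq_bigr (fun=> theta b)) => [|s /eqP-> //].
rewrite sumr_const mulr_natl; congr (_ *+ _).
by rewrite /weight cardsE.
Qed.

Lemma rare_coordinateP : (forall b, 0 < theta b) ->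
  weighted_theta < 2 -> theta_max = 1 ->
  exists s : 'I_r, rare_coordinate = s.+1 /\
    forall s' : 'I_r, theta (a s') = 1 <-> s' = s.
Proof.
move=> th0; rewrite weighted_thetaE => lt2 max1.
have uniq1 (s s' : 'I_r) : theta (a s) = 1 -> theta (a s') = 1 -> s' = s.
  move=> h h'; apply/eqP; apply: contraLR lt2 => ss'; rewrite -leNgt.
  rewrite (bigD1 s) //= (bigD1 s') //= h h' addrA lerDl.
  by apply: sumr_ge0 => i _; apply: ltW.
have hasP1 : has (fun s => theta (a s) == 1) (enum 'I_r).
  have: theta_max != 0 -> exists2 b, b \in palette_set a & theta_max = theta b.
    rewrite /theta_max; elim/big_ind: _ => [|x y hx hy|b ba _]; first by rewrite eqxx.
      by rewrite /Num.max; case: ifP.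
    by exists b.
  rewrite max1 oner_eq0 => /(_ isT) [_ /imsetP[s _ ->] th1].
  by apply/hasP; exists s; rewrite ?mem_enum // -th1.
have := hasP1; rewrite has_find size_enum_ord => ltr.
exists (Ordinal ltr); split=> // s'; split=> [h|->]; last first.
  have := nth_find (Ordinal ltr) hasP1.
  rewrite -[X in nth _ _ X]/(nat_of_ord (Ordinal ltr)) nth_ord_enum.
  by move/eqP.
apply: uniq1 => //; have := nth_find (Ordinal ltr) hasP1.
rewrite -[X in nth _ _ X]/(nat_of_ord (Ordinal ltr)) nth_ord_enum.
by move/eqP.
Qed.

End Palette.

(* The function lambda_a, where s is the (1-based) rare coordinate. *)
Definition lambda (R : realType) (r s : nat) (x : R) : R :=
  if s == 1%N then (1 - x) / (r - s)%:R
  else if s == r then x / (s - 1)%:R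
  else Num.min (x / (s - 1)%:R) ((1 - x) / (r - s)%:R).

Local Open Scope classical_set_scope.

Section Probability.
Context d (T : measurableType d) (R : realType) (P : probability T R).

(* U is equipped with the discrete sigma-algebra: these notions are meant for
   random variables with values in a countable type. *)
Definition discrete_rv (U : Type) (X : T -> U) : Prop :=
  forall B : set U, measurable (X @^-1` B).

Definition mutually_independent (I : finType) (U : Type) (X : I -> T -> U) :
    Prop :=
  forall (J : {set I}) (B : I -> set U),
    P (\bigcap_(i in [set` J]) X i @^-1` B i) =
    (\prod_(i in J) P (X i @^-1` B i))%E.

Definition color_prob (c : nat) (theta : 'I_c.-1 -> R) (n : nat) (b : 'I_c) : R :=
  if insub (b : nat) is Some b' then n%:R `^ (- theta b')
  else 1 - \sum_(b' < c.-1) n%:R `^ (- theta b').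

Definition random_coloring (c : nat) (theta : 'I_c.-1 -> R) (n : nat)
    (phi : T -> {ffun 'I_n -> 'I_c}) : Prop :=
  [/\ forall i, discrete_rv (fun w => phi w i),
      forall i b, P [set w | phi w i = b] = (color_prob theta n b)%:E &
      mutually_independent (fun i w => phi w i)].

Definition count_in (N : T -> set R) (A : set R) (w : T) : nat :=
  #|` fset_set (N w `&` A)|.

(* A homogeneous Poisson point process of the given rate on a set D of finite
   Lebesgue measure, as a random finite subset of D.  The second argument of
   [poisson_prob] is a dummy. *)
Definition poisson_point_process (rate : R) (D : set R) (N : T -> set R) :
    Prop :=
  [/\ forall w, finite_set (N w) /\ N w `<=` D,
      forall A, measurable A -> A `<=` D ->
        discrete_rv (count_in N A) /\
        forall B : set nat, P (count_in N A @^-1` B) =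
          poisson_prob (rate * fine (lebesgue_measure A)) 0%N B &
      forall (m : nat) (A : 'I_m -> set R),
        (forall i, measurable (A i) /\ A i `<=` D) -> trivIset setT A ->
        mutually_independent (fun i => count_in N (A i))].

End Probability.

(* The X n may live on different probability spaces; only large n matter. *)
Definition cvg_in_distribution (R : realType) (d : nat -> measure_display)
    (T : forall n, measurableType (d n)) (P : forall n, probability (T n) R)
    (X : forall n, T n -> R)
    (d' : measure_display) (T' : measurableType d') (Q : probability T' R)
    (Y : T' -> R) : Prop :=
  [/\ \forall n \near \oo, measurable_fun setT (X n),
      measurable_fun setT Y &
      forall y : R,
        {for y, continuous (fun z => fine (Q [set w | Y w <= z]))} ->
        P n [set w | X n w <= y] @[n --> \oo] --> Q [set w | Y w <= y]].

(* Main.v *)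
Require Import Defs.
From mathcomp Require Import all_boot all_order all_algebra finmap.
From mathcomp Require Import all_classical all_reals all_analysis.
From mathcomp Require Import measurable_realfun.
From mathcomp Require Import ring lra zify.

Set Implicit Arguments.
Unset Strict Implicit.
Unset Printing Implicit Defensive.

Import Order.TTheory GRing.Theory Num.Theory.
Import numFieldNormedType.Exports.

Local Open Scope ring_scope.

(** In the limit only the positions of the elements of the rare color, each
    present with probability 1/n, remain random.  There are n lambda(k/n) + O(1)
    APs with the point k at the rare coordinate and, if k is rare, each of them
    is colorful with probability q, the product of the other p's.  An AP shares
    a further point with at most r^2 others, so the variance of the number of
    colorful ones is O(n q), while n q = n^(2 - sum w_b theta_b) tends to
    infinity: by a second moment bound, X = n q W + o(n q) in probability, where
    W is the sum of lambda(k/n) over the rare k.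

    As lambda is 1-Lipschitz, W, and likewise the sum over the Poisson process,
    is up to (number of points)/M a function of the numbers of points in the M
    intervals [i/M, (i+1)/M[.  The joint law of these counts converges to that
    of independent Poisson variables of parameter 1/M.  Truncating the total
    number of points to at most K leaves finitely many values of the counts, and
    yields a sandwich for the distribution functions. *)

(** * Finite product measures *)

Section ProductMeasure.
Variables (R : realFieldType) (I J : finType) (p : J -> R).
Hypothesis p_ge0 : forall j, 0 <= p j.
Hypothesis p_sum1 : \sum_j p j = 1.

Definition mass (f : {ffun I -> J}) : R := \prod_i p (f i).

(** Probabilities are written as expectations of indicators, so that the discrete part of the
    argument consists of finite sums. *)
Definition expect (g : {ffun I -> J} -> R) : R := \sum_f mass f * g f.

Lemma mass_ge0 f : 0 <= mass f.
Proof. exact: prodr_ge0. Qed.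

(** Independence of the coordinates: a product of sums expands into a sum over choice functions. *)
Lemma expect_box (Q : I -> pred J) :
  expect (fun f => [forall i, Q i (f i)]%:R) = \prod_i \sum_(j | Q i j) p j.
Proof.
rewrite bigA_distr_big_dep /expect big_mkcond [RHS]big_mkcond /=.
rewrite [RHS]big_mkcond; apply: eq_bigr => f _.
have -> : (f \in family Q) = [forall i, Q i (f i)] by [].
by case: ifP => _; rewrite ?mulr1 ?mulr0.
Qed.

Lemma expect1 : expect (fun=> 1) = 1.
Proof.
have -> : expect (fun=> 1) = expect (fun f => [forall i : I, true]%:R).
  by apply: eq_bigr => f _; case: forallP => // -[].
by rewrite (expect_box (fun _ => predT)) big1.
Qed.

Lemma eq_expect g h : g =1 h -> expect g = expect h.
Proof. by move=> gh; apply: eq_bigr => f _; rewrite gh. Qed.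

Lemma expect_le g h : (forall f, g f <= h f) -> expect g <= expect h.
Proof. by move=> gh; apply: ler_sum => f _; rewrite ler_wpM2l ?mass_ge0. Qed.

Lemma expectD g h : expect (fun f => g f + h f) = expect g + expect h.
Proof.
by rewrite -big_split /=; apply: eq_bigr => f _; rewrite mulrDr.
Qed.

Lemma expectZ a g : expect (fun f => a * g f) = a * expect g.
Proof. by rewrite mulr_sumr; apply: eq_bigr => f _; rewrite mulrCA. Qed.

Lemma expect_sum (K : finType) (D : pred K) (g : K -> {ffun I -> J} -> R) :
  expect (fun f => \sum_(k | D k) g k f) = \sum_(k | D k) expect (g k).
Proof.
by rewrite exchange_big; apply: eq_bigr => f _; rewrite mulr_sumr.
Qed.

(** Conditions at distinct points are independent. The index type [K] is arbitrary, so that one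
    progression or two joined ones can be plugged in. *)
Lemma expect_cylinder (K : finType) (D : {pred K}) (t : K -> I) (b : K -> J) :
  {in D &, injective t} ->
  expect (fun f => [forall (k | k \in D), f (t k) == b k]%:R) =
  \prod_(k in D) p (b k).
Proof.
move=> tinj.
(* A coordinate [i] hit by [t] is constrained by exactly one [k], by injectivity; at any other [i]
   the box is full and has mass 1. *)
pose Q i j := [forall (k | k \in D), (t k == i) ==> (j == b k)].
transitivity (expect (fun f => [forall i, Q i (f i)]%:R)).
  apply: eq_expect => f; congr (nat_of_bool _)%:R; apply/idP/idP.
    move=> /forall_inP h; apply/forallP => i; apply/forall_inP => k kD.
    by apply/implyP => /eqP<-; apply: h.
  move=> /forallP h; apply/forall_inP => k kD.
  by have /forall_inP/(_ k kD)/implyP := h (t k); apply.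
rewrite expect_box (bigID (mem (t @: D))) /= mulrC big1 ?mul1r; last first.
  move=> i iND; rewrite -[RHS]p_sum1; apply: eq_bigl => j.
  apply/forall_inP => k kD; apply/implyP => /eqP tk.
  by move: iND; rewrite -tk imset_f.
rewrite big_imset //=; apply: eq_bigr => k kD.
rewrite (eq_bigl (pred1 (b k))) ?big_pred1_eq // => j.
apply/forall_inP/eqP => [/(_ k kD)|-> k' k'D]; first by rewrite eqxx => /eqP.
by apply/implyP => /eqP/tinj ->.
Qed.

Lemma markov_expect (g : {ffun I -> J} -> R) (e : R) :
  0 < e -> (forall f, 0 <= g f) ->
  expect (fun f => (e < g f)%R%:R) <= expect g / e.
Proof.
move=> e0 g0; rewrite ler_pdivlMr // mulrC -expectZ; apply: expect_le => f.
by case: ltP => h; rewrite ?mulr1 ?mulr0 // ltW.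
Qed.

End ProductMeasure.

(** * Progressions through a given point *)

Section Progressions.
Variables (r n : nat).
Implicit Types (t : {ffun 'I_r -> 'I_n}) (k : 'I_n).

Lemma is_AP_inj t : is_AP t -> injective t.
Proof.
move=> /existsP[x /existsP[d /andP[d0 /forallP td]]] s s' tss'.
apply/val_inj/eqP; move: (td s) (td s'); rewrite tss' => /eqP-> /eqP.
by move=> /eqP; rewrite eqn_add2l eqn_pmul2r.
Qed.

(** The entries at two positions determine the difference, then the starting point. *)
Lemma is_AP_ext t t' s s' : is_AP t -> is_AP t' -> s != s' ->
  t s = t' s -> t s' = t' s' -> t = t'.
Proof.
move=> /existsP[x /existsP[d /andP[d0 /forallP td]]].
move=> /existsP[x' /existsP[d' /andP[d'0 /forallP td']]] ss' ts ts'.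
have e1 := eqP (td s); have e1' := eqP (td' s).
have e2 := eqP (td s'); have e2' := eqP (td' s').
rewrite ts e1' in e1; rewrite ts' e2' in e2.
have neq : (s : nat) != s' by [].
have dd : d = d' :> nat by nia.
apply/ffunP => i; apply/val_inj => /=.
rewrite (eqP (td i)) (eqP (td' i)) dd; move: e1; rewrite dd; lia.
Qed.

Definition AP_at (s0 : 'I_r) k : {set {ffun 'I_r -> 'I_n}} :=
  [set t | is_AP t && (t s0 == k)].

(* The tests discard the bound whose denominator is 0, where x %/ 0 = 0. *)
Definition reach (s0 k : nat) : nat :=
  if s0 == 0%N then ((n - k.+1) %/ r.-1)%N
  else if s0 == r.-1 then (k %/ s0)%N
  else minn (k %/ s0) ((n - k.+1) %/ (r.-1 - s0)).

(** The two conditions keep the first and the last term in range, so [reach] is the largest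
    difference available with [k] at position [s0]. *)
Lemma leq_reach (s0 : 'I_r) k d : (1 < r)%N -> (d <= reach s0 k)%N =
  ((s0 * d <= k) && (k + (r.-1 - s0) * d < n))%N.
Proof.
move=> r1; have ltk := ltn_ord k; have lts := ltn_ord s0.
rewrite /reach; case: eqP => [->|/eqP s00].
  by rewrite leq_divRL ?subn0 1?mulnC //; lia.
case: eqP => [->|/eqP s0r].
  by rewrite leq_divRL 1?mulnC ?subnn ?mul0n ?addn0; lia.
rewrite leq_min !leq_divRL; [|lia|lia].
by rewrite (mulnC d) (mulnC d); congr (_ && _); lia.
Qed.

Lemma card_AP_at (s0 : 'I_r) k : (1 < r)%N -> #|AP_at s0 k| = reach s0 k.
Proof.
move=> r1; have ltk := ltn_ord k; have lts := ltn_ord s0.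
(* The progressions are enumerated by their difference [j.+1]. The default of [insubd] is never
   taken, as [apE] shows. *)
pose ap (j : 'I_(reach s0 k)) : {ffun 'I_r -> 'I_n} :=
  [ffun s : 'I_r => insubd k (k - s0 * j.+1 + s * j.+1)%N].
have apE j s : ap j s = (k - s0 * j.+1 + s * j.+1)%N :> nat.
  rewrite ffunE val_insubd; case: ifP => // /negP[].
  have := ltn_ord j; rewrite -ltnS ltnS leq_reach // => /andP[h1 h2].
  by have := ltn_ord s; nia.
have apinj : injective ap.
  move=> j j' e; apply/val_inj.
  (* The difference is read off at any position other than [s0]. *)
  have [s ss] : exists s : 'I_r, s != s0.
    case: (eqVneq (s0 : nat) 0%N) => s00.
      by exists (Ordinal r1); rewrite -val_eqE /= s00.
    by exists (Ordinal (ltnW r1)); rewrite -val_eqE /= eq_sym.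
  have := apE j s; rewrite e apE; have := ltn_ord j; have := ltn_ord j'.
  rewrite !leq_reach // => /andP[h1 _] /andP[h2 _].
  have {}ss : (s : nat) != s0 by [].
  move=> /=; set u := nat_of_ord j; set v := nat_of_ord j' => e1; apply/eqP.
  case: (ltngtP u v) => // uv.
    by case: (ltngtP (s : nat) s0) ss => // ss _; nia.
  by case: (ltngtP (s : nat) s0) ss => // ss _; nia.
rewrite -[RHS]card_ord -(card_imset _ apinj).
apply: eq_card => t; rewrite inE; apply/andP/imsetP.
  move=> [/existsP[x /existsP[d /andP[d0 /forallP td]]] /eqP ts0].
  have lr : (r.-1 < r)%N by lia.
  have := eqP (td (Ordinal lr)); have := ltn_ord (t (Ordinal lr)) => /= tn tr.
  have ks := eqP (td s0); rewrite ts0 in ks.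
  have lj : (d.-1 < reach s0 k)%N.
    by rewrite leq_reach // prednK //; nia.
  exists (Ordinal lj) => //; apply/ffunP => s; apply/val_inj.
  rewrite /= apE (eqP (td s)) /= prednK // ks; lia.
move=> [j _ ->]; have := ltn_ord j; rewrite leq_reach // => /andP[h1 h2].
have ltx : (k - s0 * j.+1 < n)%N by lia.
(* The encoding of progressions asks for a difference at most [n]: the room to the right of [k]
   gives it if [s0] is 0, the room to the left otherwise. *)
have ltj : (j.+1 < n.+1)%N.
  case: (eqVneq (s0 : nat) 0%N) => s00; first by nia.
  by nia.
split; last by apply/eqP/val_inj; rewrite /= apE; lia.
apply/existsP; exists (Ordinal ltx); apply/existsP; exists (Ordinal ltj) => /=.
by apply/forallP => s; rewrite apE.
Qed.

End Progressions.

(** * The function lambda as the limit of the number of progressions through a point *)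

Section Lambda.
Variable R : realType.

Lemma minr_dist (u v u' v' e : R) : `|u - u'| <= e -> `|v - v'| <= e ->
  `|Num.min u v - Num.min u' v'| <= e.
Proof.
rewrite !ler_norml => /andP[a1 a2] /andP[b1 b2].
by rewrite /Num.min; case: ltP => h; case: ltP => h'; lra.
Qed.

(** The slopes have absolute value 1/(s-1) and 1/(r-s), at most 1, and a minimum keeps the bound. *)
Lemma lambda_lipschitz (r s : nat) (x y : R) : (1 < r)%N -> (1 <= s <= r)%N ->
  `|lambda r s x - lambda r s y| <= `|x - y|.
Proof.
move=> r1 /andP[s1 sr].
have divl (k : nat) (u v : R) : `|u - v| <= `|x - y| -> (0 < k)%N ->
    `|u / k%:R - v / k%:R| <= `|x - y|.
  move=> uv k0; rewrite -mulrBl normrM; apply: le_trans uv.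
  rewrite ler_piMr // normfV normr_nat invf_le1 ?ltr0n // ler1n //.
have d1 : `|1 - x - (1 - y)| <= `|x - y|.
  by rewrite (_ : _ - _ = y - x) 1?distrC //; ring.
rewrite /lambda; case: eqP => [->|/eqP s1']; first by apply: divl => //; lia.
case: eqP => [->|/eqP sr']; first by apply: divl => //; lia.
by apply: minr_dist; apply: divl => //; lia.
Qed.

Lemma divn_dist (m b : nat) : (0 < b)%N ->
  `|(m %/ b)%:R - m%:R / b%:R| <= 1 :> R.
Proof.
move=> b0; have b0' : 0 < b%:R :> R by rewrite ltr0n.
rewrite ler_norml; apply/andP; split.
  rewrite lerBrDr addrC lerBlDr ler_pdivrMr // natr1 -natrM ler_nat ltnW //.
  exact: ltn_ceil.
rewrite lerBlDr ler_wpDl // ler_pdivlMr // -natrM ler_nat.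
exact: leq_trunc_div.
Qed.

(** One unit of error comes from the integer division, the other from [n - k.+1] standing in for
    [n - k]. *)
Lemma reach_lambda (r n : nat) (s0 : 'I_r) (k : 'I_n) : (1 < r)%N ->
  `|(reach r n s0 k)%:R - n%:R * lambda r s0.+1 (k%:R / n%:R)| <= 2 :> R.
Proof.
move=> r1; have ltk := ltn_ord k; have lts := ltn_ord s0.
have n0 : n%:R != 0 :> R by rewrite pnatr_eq0; lia.
have up (b : nat) : (0 < b)%N ->
    `|((n - k.+1) %/ b)%:R - n%:R * ((1 - k%:R / n%:R) / b%:R)| <= 2 :> R.
  move=> b0; have := divn_dist (n - k.+1) b0.
  have -> : (n - k.+1)%:R = n%:R - k%:R - 1 :> R.
    by rewrite natrB // -natr1 opprD addrA.
  have b0' : 0 < b%:R :> R by rewrite ltr0n.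
  have b1 : b%:R^-1 <= 1 :> R by rewrite invf_le1 // ler1n.
  have b2 : 0 <= b%:R^-1 :> R by rewrite invr_ge0 ltW.
  have -> : n%:R * ((1 - k%:R / n%:R) / b%:R) = (n%:R - k%:R) * b%:R^-1 :> R.
    by rewrite mulrA mulrBr mulr1 mulrCA divff // mulr1.
  by rewrite mulrBl mul1r !ler_norml; move=> /andP[? ?]; lra.
have dn (b : nat) : (0 < b)%N ->
    `|(k %/ b)%:R - n%:R * (k%:R / n%:R / b%:R)| <= 2 :> R.
  move=> b0; have := divn_dist k b0.
  rewrite mulrA (mulrCA n%:R) divff // mulr1 => h; apply: le_trans h _.
  by rewrite ler1n.
rewrite /reach /lambda eqSS; case: eqP => [->|/eqP s00].
  by rewrite subn1; apply: up; lia.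
have -> : (s0.+1 == r) = (s0 == r.-1 :> nat) by lia.
rewrite subn1 /=; case: eqP => [_|/eqP s0r]; first by apply: dn; lia.
have -> : (r - s0.+1 = r.-1 - s0)%N by lia.
rewrite -minEnat natr_min minr_pMr //.
by apply: minr_dist; [apply: dn|apply: up]; lia.
Qed.

End Lambda.

(** * Concentration around the rare elements *)

Section SecondMoment.
Variables (R : realType) (c r n : nat) (p : 'I_c -> R).
Hypothesis p_ge0 : forall j, 0 <= p j.
Hypothesis p_sum1 : \sum_j p j = 1.
Variables (a : {ffun 'I_r -> 'I_c}) (s0 : 'I_r).
Hypothesis r_gt1 : (1 < r)%N.

Notation coloring := {ffun 'I_n -> 'I_c}.
Implicit Types (f : coloring) (t : {ffun 'I_r -> 'I_n}).
Local Notation E := (expect p).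

(** The conditional probability that a progression is colorful, given that its entry at [s0] has the
    right color. *)
Definition companion_prob : R := \prod_(s | s != s0) p (a s).
Local Notation q := companion_prob.

Lemma companion_prob_ge0 : 0 <= q.
Proof. exact: prodr_ge0. Qed.

Lemma prob_le1 j : p j <= 1.
Proof. by rewrite -p_sum1 (bigD1 j) //= lerDl sumr_ge0. Qed.

Lemma companion_prob_le1 : q <= 1.
Proof. by apply: prodr_ile1 => s _; rewrite p_ge0 prob_le1. Qed.

Definition rare_at (k : 'I_n) (f : coloring) : R := (f k == a s0)%:R.

(** Progressions are grouped by their entry at [s0]; the group of [k] contributes only when [k] is
    rare. *)
Definition colorful_at (k : 'I_n) (f : coloring) : R :=
  \sum_(t in AP_at s0 k) (colorful f a t)%:R.

Lemma num_colorfulE (f : coloring) :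
  (num_colorful_AP f a)%:R = \sum_k colorful_at k f.
Proof.
rewrite /num_colorful_AP -sum1_card natr_sum.
rewrite (partition_big (fun t : {ffun 'I_r -> 'I_n} => t s0) predT) //=.
apply: eq_bigr => k _; rewrite /colorful_at big_mkcond [RHS]big_mkcond /=.
apply: eq_bigr => t _; rewrite !inE.
by case: (is_AP t); case: colorful; case: (t s0 == k).
Qed.

Lemma expect_rare k : E (rare_at k) = p (a s0).
Proof.
have -> : p (a s0) = \prod_(u in pred1 tt) p (a s0) by rewrite (big_pred1 tt).
rewrite -(expect_cylinder p_sum1 (D := pred1 tt) (t := fun=> k)); last first.
  by move=> [] [].
apply: eq_expect => f; congr (nat_of_bool _)%:R.
by apply/idP/forall_inP => [h [] _|/(_ tt)]; [|apply].
Qed.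

Lemma expect_colorful t : is_AP t ->
  E (fun f => (colorful f a t)%:R) = p (a s0) * q.
Proof.
move=> /is_AP_inj tinj; rewrite -(bigD1 (P := predT) s0) //=.
rewrite -(expect_cylinder p_sum1 (D := predT) (t := t) a); last first.
  by move=> ? ? _ _; apply: tinj.
by apply: eq_expect.
Qed.

(** The exceptional partners of [t]: for every other progression with the same entry at [s0], the
    remaining colors are independent of those of [t]. *)
Definition meets t : {set {ffun 'I_r -> 'I_n}} :=
  [set t' in AP_at s0 (t s0) | [exists u : 'I_r * 'I_r,
    (u.2 != s0) && (t u.1 == t' u.2)]].

(** A pair of positions where the two progressions coincide, together with the common entry at [s0],
    determines [t'] by [is_AP_ext]. *)
Lemma card_meets t : (#|meets t| <= r * r)%N.
Proof.
(* The default pair is reached only outside [meets t]. *)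
pose g (t' : {ffun 'I_r -> 'I_n}) : 'I_r * 'I_r :=
  odflt (s0, s0) [pick u : 'I_r * 'I_r | (u.2 != s0) && (t u.1 == t' u.2)].
have gP t' : t' \in meets t -> ((g t').2 != s0) && (t (g t').1 == t' (g t').2).
  rewrite inE /g => /andP[_ /existsP[u hu]].
  by case: pickP => //= /(_ u); rewrite hu.
rewrite -(card_in_imset (f := g)); last first.
  move=> t1 t2 m1 m2 e; have := gP _ m1; have := gP _ m2; rewrite e.
  move=> /andP[d2 /eqP e2] /andP[_ /eqP e1].
  move: m1 m2; rewrite !inE.
  move=> /andP[/andP[A1 /eqP k1] _] /andP[/andP[A2 /eqP k2] _].
  by apply: (is_AP_ext A1 A2 d2); rewrite ?k1 ?k2 // -e1 -e2.
by apply: leq_trans (max_card _) _; rewrite card_prod !card_ord.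
Qed.

Lemma expect_colorful2_le t t' : is_AP t -> is_AP t' ->
  E (fun f => (colorful f a t)%:R * (colorful f a t')%:R) <= p (a s0) * q.
Proof.
move=> At At'; rewrite -(expect_colorful At); apply: expect_le => // f.
by case: colorful; case: colorful; rewrite ?mulr1 ?mulr0.
Qed.

(** The two progressions cover 2r-1 distinct points. The shared one is counted once, hence a single
    factor [p (a s0)]. *)
Lemma expect_colorful2 t t' : is_AP t -> is_AP t' -> t' s0 = t s0 ->
  t' \notin meets t ->
  E (fun f => (colorful f a t)%:R * (colorful f a t')%:R) = p (a s0) * q ^+ 2.
Proof.
move=> At At' tt0; rewrite !inE At' tt0 eqxx /= negb_exists => /forallP dis.
(* The points are indexed by two copies of the positions, the second one without [s0]. *)
pose D : {pred 'I_r + 'I_r} :=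
  fun u => if u is inr s then s != s0 else true.
pose T (u : 'I_r + 'I_r) := match u with inl s => t s | inr s => t' s end.
pose b (u : 'I_r + 'I_r) := match u with inl s => a s | inr s => a s end.
have Tinj : {in D &, injective T}.
  move=> [s|s] [s'|s'] //=; rewrite /in_mem /= => Ds Ds' e.
  - by rewrite (is_AP_inj At e).
  - by have := dis (s, s'); rewrite /= Ds' e eqxx.
  - by have := dis (s', s); rewrite /= Ds e eqxx.
  - by rewrite (is_AP_inj At' e).
have -> : p (a s0) * q ^+ 2 = \prod_(u in D) p (b u).
  rewrite big_sumType /= expr2 mulrA; congr (_ * _).
  by rewrite [RHS](bigD1 (P := predT) s0).
rewrite -(expect_cylinder p_sum1 _ Tinj); apply: eq_expect => f.
rewrite -natrM mulnb; congr (nat_of_bool _)%:R; apply/idP/idP.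
  by move=> /andP[/forallP h /forallP h']; apply/forall_inP => -[s|s] _ /=.
move=> /forall_inP h; apply/andP; split; apply/forallP => s.
  exact: (h (inl s)).
case: (eqVneq s s0) => [->|ss]; last exact: (h (inr s)).
by rewrite tt0; apply: (h (inl s0)).
Qed.

Lemma expect_colorful_at k :
  E (colorful_at k) = #|AP_at s0 k|%:R * (p (a s0) * q).
Proof.
rewrite /colorful_at expect_sum.
rewrite (eq_bigr (fun=> p (a s0) * q)) ?sumr_const ?mulr_natl //.
by move=> t; rewrite inE => /andP[/expect_colorful].
Qed.

(** In the double sum over pairs, a generic pair contributes [p (a s0) * q ^+ 2], while each [t] has
    at most r^2 exceptional partners, contributing at most [p (a s0) * q]. *)
Lemma expect_colorful_at_sqr k :
  E (fun f => colorful_at k f ^+ 2) <=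
  p (a s0) * ((#|AP_at s0 k|%:R * q) ^+ 2 +
              (r * r)%:R * (#|AP_at s0 k|%:R * q)).
Proof.
set M : R := #|AP_at s0 k|%:R.
have -> : E (fun f => colorful_at k f ^+ 2) =
    \sum_(t in AP_at s0 k) \sum_(t' in AP_at s0 k)
      E (fun f => (colorful f a t)%:R * (colorful f a t')%:R).
  rewrite -[RHS](eq_bigr _ (fun t _ => expect_sum _ _ _)) -expect_sum.
  apply: eq_expect => f; rewrite expr2 {1}/colorful_at mulr_suml.
  by apply: eq_bigr => t _; rewrite mulr_sumr.
have step t : t \in AP_at s0 k ->
    \sum_(t' in AP_at s0 k)
      E (fun f => (colorful f a t)%:R * (colorful f a t')%:R) <=
    M * (p (a s0) * q ^+ 2) + (r * r)%:R * (p (a s0) * q).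
  rewrite inE => /andP[At /eqP tk].
  have pq0 : 0 <= p (a s0) * q by rewrite mulr_ge0 ?companion_prob_ge0.
  have pq20 : 0 <= p (a s0) * q ^+ 2.
    by rewrite mulr_ge0 // exprn_ge0 ?companion_prob_ge0.
  have sub : meets t \subset AP_at s0 k.
    by apply/fintype.subsetP => t'; rewrite !inE tk => /andP[].
  (* Adding the exceptional contribution to the generic one bounds both cases by one formula. *)
  apply: (@le_trans _ _ (\sum_(t' in AP_at s0 k)
    (p (a s0) * q ^+ 2 + (t' \in meets t)%:R * (p (a s0) * q)))).
    apply: ler_sum => t'; rewrite inE => /andP[At' /eqP tk'].
    case: (boolP (t' \in meets t)) => mt.
      rewrite mul1r; apply: le_trans (expect_colorful2_le At At') _.
      by rewrite lerDr.
    by rewrite mul0r addr0 expect_colorful2 // tk tk'.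
  rewrite big_split /= sumr_const -[X in X + _ <= _]mulr_natl lerD2l -mulr_suml.
  apply: ler_wpM2r => //; rewrite -natr_sum ler_nat.
  apply: leq_trans (card_meets t); rewrite -sum1_card big_mkcond.
  rewrite [leqRHS]big_mkcond /=; apply: leq_sum => t' _.
  by case: ifP => // _; case: (t' \in meets t).
apply: le_trans (ler_sum _ step) _; rewrite sumr_const -[leLHS]mulr_natl -/M.
by rewrite le_eqVlt; apply/orP; left; apply/eqP; ring.
Qed.

Lemma expect_dist_colorful_at k (mu tau : R) : 0 < tau ->
  E (fun f => `|colorful_at k f - mu * rare_at k f|) <=
  p (a s0) * (tau + ((#|AP_at s0 k|%:R * q - mu) ^+ 2 +
                     (r * r)%:R * (#|AP_at s0 k|%:R * q)) / tau) / 2.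
Proof.
set M : R := #|AP_at s0 k|%:R => tau0.
(* AM-GM: [2 |w| <= tau + w^2 / tau], which avoids the square root in
   Cauchy-Schwarz; off the event that k is rare both sides vanish. *)
have pt f : `|colorful_at k f - mu * rare_at k f| <=
   2^-1 * (tau * rare_at k f + tau^-1 * (colorful_at k f ^+ 2 +
     ((- 2 * mu) * colorful_at k f + mu ^+ 2 * rare_at k f))).
  set Z := colorful_at k f; rewrite /rare_at; case: eqP => fk; last first.
    have -> : Z = 0.
      rewrite /Z /colorful_at big1 // => t; rewrite inE => /andP[_ /eqP tk].
      rewrite (_ : colorful f a t = false) //; apply/negbTE.
      by rewrite negb_forall; apply/existsP; exists s0; rewrite tk; apply/eqP.
    by rewrite expr0n !mulr0 !addr0 !mulr0 subr0 normr0 addr0 mulr0.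
  rewrite !mulr1; set w := Z - mu.
  have -> : Z ^+ 2 + (-2 * mu * Z + mu ^+ 2) = w ^+ 2 by rewrite /w; ring.
  rewrite -(real_normK (num_real w)) ler_pdivlMl // mulr_natl.
  have : 0 <= tau^-1 * (tau - `|w|) ^+ 2.
    by rewrite mulr_ge0 ?sqr_ge0 // invr_ge0 ltW.
  have -> : tau^-1 * (tau - `|w|) ^+ 2 =
    tau + tau^-1 * `|w| ^+ 2 - `|w| *+ 2 by field; rewrite gt_eqF.
  by rewrite subr_ge0.
apply: le_trans (expect_le p_ge0 pt) _.
rewrite expectZ expectD expectZ expectZ expectD expectD !expectZ.
rewrite expect_rare expect_colorful_at -/M.
set V := _ + (r * r)%:R * _.
have -> : p (a s0) * (tau + V / tau) / 2 =
    2^-1 * (tau * p (a s0) + tau^-1 * (p (a s0) * V)) by field; rewrite gt_eqF.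
rewrite ler_pM2l ?invr_gt0 // lerD2l ler_pM2l ?invr_gt0 // /V.
have := expect_colorful_at_sqr k; rewrite -/M /= => h.
(* Once the second moment is bounded, the remaining terms complete the square
   [(M * q - mu) ^+ 2]. *)
apply: (@le_trans _ _ (p (a s0) * ((M * q) ^+ 2 + (r * r)%:R * (M * q)) +
  (- 2 * mu * (M * (p (a s0) * q)) + mu ^+ 2 * p (a s0)))).
  by rewrite lerD2r.
by rewrite le_eqVlt; apply/orP; left; apply/eqP; ring.
Qed.

Lemma reach_le (k : 'I_n) : (reach r n s0 k <= n)%N.
Proof.
have := leqnn (reach r n s0 k); rewrite leq_reach // => /andP[h1 h2].
by have := ltn_ord k; have := ltn_ord s0; nia.
Qed.

(** The discrete counterpart of the sum over the Poisson process, a rare [k] being a point at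
    k/n. *)
Definition rare_sum (f : coloring) : R :=
  \sum_(k < n) rare_at k f * lambda r s0.+1 (k%:R / n%:R).

(** The bounds for the [n] points each carry a factor [p (a s0)], so their sum is a single bound.
    The 4 is the square of the error in [reach_lambda], as [q] is at most 1; [reach_le] bounds the
    other term. *)
Lemma expect_dist_num_colorful (tau : R) : n%:R * p (a s0) = 1 -> 0 < tau ->
  E (fun f => `|(num_colorful_AP f a)%:R - n%:R * q * rare_sum f|) <=
  (tau + (4 + (r * r)%:R * (n%:R * q)) / tau) / 2.
Proof.
move=> np tau0.
pose mu (k : 'I_n) : R := n%:R * q * lambda r s0.+1 (k%:R / n%:R).
apply: (@le_trans _ _
  (E (fun f => \sum_k `|colorful_at k f - mu k * rare_at k f|))).
  apply: expect_le => // f; rewrite num_colorfulE /rare_sum mulr_sumr -sumrB.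
  apply: le_trans (ler_norm_sum _ _ _) _; apply: ler_sum => k _.
  by rewrite /mu mulrA mulrAC.
rewrite expect_sum.
apply: (@le_trans _ _ (\sum_(k < n) p (a s0) *
    (tau + (4 + (r * r)%:R * (n%:R * q)) / tau) / 2)); last first.
  by rewrite sumr_const card_ord -[leLHS]mulr_natl !mulrA np mul1r.
apply: ler_sum => k _; apply: le_trans (expect_dist_colorful_at _ _ tau0) _.
rewrite -!mulrA ler_wpM2l // ler_pM2r ?invr_gt0 // lerD2l.
rewrite ler_pM2r ?invr_gt0 // card_AP_at //; apply: lerD; last first.
  rewrite ler_wpM2l // ler_wpM2r ?companion_prob_ge0 // ler_nat.
  exact: reach_le.
have -> : 4 = 2 ^+ 2 :> R by rewrite -natrX.
rewrite -[leLHS]real_normK ?num_real // lerXn2r ?nnegrE //.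
have -> : (reach r n s0 k)%:R * q - mu k =
   ((reach r n s0 k)%:R - n%:R * lambda r s0.+1 (k%:R / n%:R)) * q.
  by rewrite /mu mulrBl; congr (_ - _); ring.
rewrite normrM (ger0_norm companion_prob_ge0) -[leRHS]mulr1.
by apply: ler_pM; rewrite ?companion_prob_ge0 ?companion_prob_le1 ?reach_lambda.
Qed.

End SecondMoment.

(** * Counts of rare elements in blocks *)

Section BlockCounts.
Variables (R : realFieldType) (n c m : nat) (p : 'I_c -> R).
Hypothesis p_sum1 : \sum_j p j = 1.
Variables (b0 : 'I_c) (g : 'I_n -> 'I_m).
Local Notation E := (expect p).

Definition rare_set (f : {ffun 'I_n -> 'I_c}) : {set 'I_n} :=
  [set k | f k == b0].

Definition fiber (i : 'I_m) : {set 'I_n} := [set k | g k == i].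

Definition block_count (A : {set 'I_n}) (i : 'I_m) : nat := #|A :&: fiber i|.

Lemma sum_block_count A : (\sum_i block_count A i)%N = #|A|.
Proof.
rewrite -[RHS]sum1_card (partition_big g predT) //=; apply: eq_bigr => i _.
by rewrite /block_count -sum1_card; apply: eq_bigl => k; rewrite !inE.
Qed.

Lemma expect_rare_set A :
  E (fun f => (rare_set f == A)%:R) =
  p b0 ^+ #|A| * (1 - p b0) ^+ (n - #|A|).
Proof.
transitivity (E (fun f => [forall k, (f k == b0) == (k \in A)]%:R)).
  apply: eq_expect => f; congr (nat_of_bool _)%:R; apply/eqP/forallP.
    by move=> <- k; rewrite inE.
  by move=> h; apply/setP => k; rewrite inE (eqP (h k)).
rewrite (expect_box p (fun k j => (j == b0) == (k \in A))).
rewrite (bigID (mem A)) /=; congr (_ * _).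
  rewrite -prodr_const; apply: eq_bigr => k kA; rewrite kA.
  by rewrite (big_pred1 b0) // => j /=; rewrite eqb_id.
have -> : (n - #|A|)%N = #|~: A| by rewrite [RHS]cardsCs finset.setCK card_ord.
rewrite -prodr_const; apply: eq_big => [k|k /negbTE kA]; first by rewrite inE.
rewrite kA -p_sum1 (bigD1 b0 (P := predT)) //= addrAC subrr add0r.
by apply: eq_bigl => j; rewrite eqbF_neg.
Qed.

(** A set amounts to the family of its traces on the fibers, which are chosen independently. *)
Lemma card_block_count (v : 'I_m -> nat) :
  #|[set A | [forall i, block_count A i == v i]]| =
  (\prod_i 'C(#|fiber i|, v i))%N.
Proof.
pose Q i : pred {set 'I_n} := fun D => (D \subset fiber i) && (#|D| == v i).
transitivity (\prod_i \sum_(D | Q i D) 1)%N; last first.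
  apply: eq_bigr => i _; rewrite sum1_card -cards_draws.
  by apply: eq_card => D; rewrite inE.
rewrite bigA_distr_big_dep -sum1_card /=.
rewrite (reindex_onto (fun F : {ffun 'I_m -> {set 'I_n}} => \bigcup_i F i)
  (fun A => [ffun i => A :&: fiber i])) /=; last first.
  move=> A _; apply/setP => k; apply/bigcupP/idP => [[i _]|kA].
    by rewrite ffunE => /setIP[].
  by exists (g k) => //; rewrite ffunE !inE kA eqxx.
rewrite big_mkcond [RHS]big_mkcond /=; apply: eq_bigr => F _.
rewrite inE (_ : (\prod_(i < m) 1 = 1)%N); last by rewrite big1.
(* The fibers are disjoint, so intersecting the union with one of them gives back the corresponding
   member. *)
have eqF : (forall i, F i \subset fiber i) ->
    forall i, (\bigcup_j F j) :&: fiber i = F i.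
  move=> h i; apply/setP => k; rewrite !inE; apply/andP/idP.
    move=> [/bigcupP[j _ kj] /eqP gi].
    by have := fintype.subsetP (h j) k kj; rewrite inE -gi => /eqP->.
  move=> kF; split; first by apply/bigcupP; exists i.
  by have := fintype.subsetP (h i) k kF; rewrite inE.
congr (if _ then _ else _); apply/idP/idP.
  move=> /andP[/forallP h /eqP e].
  have e' i : (\bigcup_j F j) :&: fiber i = F i by rewrite -[in RHS]e ffunE.
  apply/forallP => i; rewrite /in_mem /= /Q -e' subsetIr /=.
  exact: h.
move=> /forallP h.
have hs i : F i \subset fiber i by have /andP[] := h i.
apply/andP; split.
  by apply/forallP => i; rewrite /block_count eqF //; have /andP[] := h i.
by apply/eqP/ffunP => i; rewrite ffunE eqF.
Qed.

(** All rare sets with these counts have the same size [s], hence the same probability; it remains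
    to count them. *)
Lemma expect_block_count (v : 'I_m -> nat) :
  let s := (\sum_i v i)%N in
  E (fun f => [forall i, block_count (rare_set f) i == v i]%:R) =
  p b0 ^+ s * (1 - p b0) ^+ (n - s) * \prod_i 'C(#|fiber i|, v i)%:R.
Proof.
move=> s; pose V := [set A | [forall i, block_count A i == v i]].
have cardV A : A \in V -> #|A| = s.
  rewrite inE => /forallP h; rewrite -sum_block_count.
  by apply: eq_bigr => i _; apply/eqP.
transitivity (E (fun f => \sum_(A in V) (rare_set f == A)%:R)).
  apply: eq_expect => f; case: (boolP [forall i, _]) => h.
    rewrite (bigD1 (rare_set f)) ?inE //= eqxx big1 ?addr0 // => A /andP[_].
    by rewrite eq_sym => /negbTE->.
  rewrite big1 // => A; rewrite inE; case: eqP => // <- h'.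
  by rewrite h' in h.
rewrite expect_sum [LHS](eq_bigr (fun=> p b0 ^+ s * (1 - p b0) ^+ (n - s))).
  rewrite sumr_const card_block_count -[LHS]mulr_natr natr_prod //.
by move=> A /cardV AV; rewrite expect_rare_set AV.
Qed.

End BlockCounts.

(** * Poisson limit of the law of the block counts *)

Section Limits.
Variable R : realType.
Local Open Scope classical_set_scope.

Lemma cvg_natinv : n%:R^-1 @[n --> \oo] --> (0 : R).
Proof.
apply/cvgrPdist_le => e e0; near=> n.
have n1 : e^-1 <= n%:R by near: n; exact: nbhs_infty_ger.
have n0 : 0 < n%:R :> R by apply: lt_le_trans n1; rewrite invr_gt0.
rewrite sub0r normrN ger0_norm ?invr_ge0 // -[leRHS]invrK.
by rewrite lef_pV2 ?posrE ?invr_gt0.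
Unshelve. all: by end_near. Qed.

Lemma cvg_onem_natinv : 1 - n%:R^-1 @[n --> \oo] --> (1 : R).
Proof.
rewrite -[X in _ --> X]subr0.
by apply: cvgB; [exact: cvg_cst|exact: cvg_natinv].
Qed.

Lemma cvg_exp (f : nat -> R) (l : R) j : f @ \oo --> l ->
  f n ^+ j @[n --> \oo] --> l ^+ j.
Proof.
move=> fl; elim: j => [|j IH].
  by under eq_fun do rewrite expr0; exact: cvg_cst.
by under eq_fun do rewrite exprS; rewrite exprS; exact: cvgM.
Qed.

(** Up to j!, the binomial is a product of [j] factors [u n - i], and each of them divided by [n]
    tends to [x]. *)
Lemma cvg_binomial (u : nat -> nat) (x : R) j :
  (u n)%:R / n%:R @[n --> \oo] --> x ->
  'C(u n, j)%:R / n%:R ^+ j @[n --> \oo] --> x ^+ j / j`!%:R.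
Proof.
move=> ux.
suff h : (u n ^_ j)%:R / n%:R ^+ j @[n --> \oo] --> x ^+ j.
  have -> : (fun n => 'C(u n, j)%:R / n%:R ^+ j) =
            (fun n => (u n ^_ j)%:R / n%:R ^+ j * j`!%:R^-1 : R).
    apply/funext => n; rewrite -bin_ffact natrM [RHS]mulrAC mulfK //.
  by apply: cvgM h (cvg_cst _).
elim: j => [|j IH].
  by under eq_fun do rewrite expr0 ffactn0 divr1; exact: cvg_cst.
have h : (u n - j)%:R / n%:R @[n --> \oo] --> x.
  apply: (@squeeze_cvgr _ _ _ _ (fun n => (u n)%:R / n%:R - j%:R * n%:R^-1)
     (fun n => (u n)%:R / n%:R)) => //; last first.
    rewrite -[X in _ --> X]subr0 -[X in _ --> _ - X](mulr0 j%:R).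
    by apply: cvgB => //; apply: cvgM; [exact: cvg_cst|exact: cvg_natinv].
  near=> n; rewrite -mulrBl !ler_wpM2r ?invr_ge0 // ?ler_nat ?leq_subr //.
  rewrite lerBlDr -natrD ler_nat; lia.
rewrite exprSr.
have -> : (fun n => (u n ^_ j.+1)%:R / n%:R ^+ j.+1) =
  (fun n => ((u n ^_ j)%:R / n%:R ^+ j) * ((u n - j)%:R / n%:R) : R).
  by apply/funext => n; rewrite ffactnSr natrM exprSr mulf_div.
exact: cvgM.
Unshelve. all: by end_near. Qed.

(** With x = 1/n, both bounds come from 1 + y <= exp y: y = -x gives the upper one, and y = x/(1-x)
    gives the lower one after inversion. *)
Lemma cvg_exp_onem : (1 - n%:R^-1) ^+ n @[n --> \oo] --> (expR (- 1) : R).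
Proof.
pose h (n : nat) : R := expR (- 1 / (1 - n%:R^-1)).
apply: (@squeeze_cvgr _ _ _ _ h (fun=> expR (- 1))); last exact: cvg_cst.
  near=> n.
  have n2 : 2 <= n%:R :> R by near: n; exact: nbhs_infty_ger.
  have n0 : 0 < n%:R :> R by lra.
  set x : R := n%:R^-1.
  have x0 : 0 < x by rewrite invr_gt0.
  have x1 : x <= 2^-1 by rewrite lef_pV2 ?posrE.
  have x1' : 0 < 1 - x by lra.
  have nx : n%:R * x = 1 by rewrite divff // gt_eqF.
  apply/andP; split; last first.
    have -> : - 1 = n%:R * - x by rewrite mulrN nx.
    rewrite expRM_natl lerXn2r ?nnegrE ?expR_ge0 ?(ltW x1') //.
    exact: expR_ge1Dx.
  have -> : h n = expR (- x / (1 - x)) ^+ n.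
    by rewrite /h -expRM_natl -/x mulrA mulrN nx.
  rewrite lerXn2r ?nnegrE ?expR_ge0 ?(ltW x1') //.
  rewrite mulNr expRN -[leRHS]invrK lef_pV2 ?posrE ?invr_gt0 ?expR_gt0 //.
  apply: le_trans (expR_ge1Dx _).
  by rewrite le_eqVlt; apply/orP; left; apply/eqP; field; rewrite gt_eqF.
have -> : expR (- 1) = expR (- 1 / 1) :> R by rewrite divr1.
rewrite /h; apply: (continuous_cvg _ (@continuous_expR R _)).
apply: cvgM; first exact: cvg_cst.
by apply: cvgV; [exact: oner_neq0|exact: cvg_onem_natinv].
Unshelve. all: by end_near. Qed.

Lemma cvg_exp_onem_sub s :
  (1 - n%:R^-1) ^+ (n - s) @[n --> \oo] --> (expR (- 1) : R).
Proof.
have h : (1 - n%:R^-1) ^+ n / (1 - n%:R^-1) ^+ s @[n --> \oo] -->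
    (expR (- 1) : R).
  rewrite -[X in _ --> X]divr1; apply: cvgM; first exact: cvg_exp_onem.
  apply: cvgV; first exact: oner_neq0.
  by have := cvg_exp (j := s) cvg_onem_natinv; rewrite expr1n.
apply: cvg_trans h; apply: near_eq_cvg; near=> n.
have n2 : (1 < n)%N by near: n; exact: nbhs_infty_gt.
have ns : (s < n)%N by near: n; exact: nbhs_infty_gt.
rewrite -[X in _ ^+ X / _](subnK (ltnW ns)) exprD mulfK // expf_neq0 //.
rewrite subr_eq0 eq_sym invr_eq1 pnatr_eq1; lia.
Unshelve. all: by end_near. Qed.

(** The index of the interval of length 1/(m+1) that contains k/n; [inord] never defaults, by
    [blockE]. *)
Definition block (m n : nat) (k : 'I_n) : 'I_m.+1 := inord (k * m.+1 %/ n).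

Lemma blockE m n (k : 'I_n) : block m k = (k * m.+1 %/ n)%N :> nat.
Proof.
have ltk := ltn_ord k; have n0 : (0 < n)%N by lia.
by rewrite /block inordK // ltn_divLR // mulnC ltn_pmul2l.
Qed.

Lemma block_dist m n (k : 'I_n) :
  `|k%:R / n%:R - (block m k)%:R / m.+1%:R| <= m.+1%:R^-1 :> R.
Proof.
have n0 : (0 < n)%N by case: k; lia.
have n0' : 0 < n%:R :> R by rewrite ltr0n.
have m0 : 0 < m.+1%:R :> R by rewrite ltr0n.
have := divn_dist R (k * m.+1) n0; rewrite -blockE => h.
have -> : k%:R / n%:R - (block m k)%:R / m.+1%:R =
   - ((block m k)%:R - (k * m.+1)%:R / n%:R) / m.+1%:R :> R.
  by rewrite natrM; field; rewrite !gt_eqF.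
by rewrite normrM normrN normfV normr_nat ler_piMl ?invr_ge0.
Qed.

(** Adding [m] before dividing by [m.+1] rounds up: the block consists of the integers from the
    ceiling of i n/(m+1) to just below that of (i+1) n/(m+1). *)
Lemma card_fiber_block m n (i : 'I_m.+1) : (0 < n)%N ->
  #|fiber (@block m n) i| =
  ((i.+1 * n + m) %/ m.+1 - (i * n + m) %/ m.+1)%N.
Proof.
move=> n0; set hi := ((i.+1 * n + m) %/ m.+1)%N.
set lo := ((i * n + m) %/ m.+1)%N.
have hin : (hi <= n)%N.
  rewrite -ltnS ltn_divLR //; have := ltn_ord i; nia.
have fiberP (k : 'I_n) : (k \in fiber (@block m n) i) = (lo <= k < hi)%N.
  have e1 : (lo <= k)%N = (i * n <= k * m.+1)%N.
    by rewrite -ltnS ltn_divLR //; lia.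
  have e2 : (k < hi)%N = (k * m.+1 < i.+1 * n)%N.
    by rewrite leq_divRL //; lia.
  rewrite inE -val_eqE /= blockE eqn_leq -ltnS ltn_divLR // leq_divRL //.
  by rewrite e1 e2 andbC.
rewrite -sum1_card (eq_bigl _ _ fiberP).
rewrite -(big_mkord (fun k => lo <= k < hi)%N (fun=> 1%N)).
have -> : (hi - lo = \sum_(lo <= k < hi) 1)%N.
  by rewrite sum_nat_const_nat muln1.
rewrite [RHS](big_nat_widenl _ 0) // [RHS](big_nat_widen _ _ n) //.
Qed.

Lemma cvg_card_fiber_block m (i : 'I_m.+1) :
  #|fiber (@block m n) i|%:R / n%:R @[n --> \oo] --> (m.+1%:R^-1 : R).
Proof.
apply/cvgrPdist_le => e e0; near=> n.
(* Each of the two integer divisions is off by at most 1. *)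
have n1 : 2 / e <= n%:R by near: n; exact: nbhs_infty_ger.
have n0 : 0 < n%:R :> R by apply: lt_le_trans n1; rewrite divr_gt0.
have n0' : (0 < n)%N by rewrite -(ltr0n R).
have m0 : 0 < m.+1%:R :> R by rewrite ltr0n.
rewrite card_fiber_block //.
set hi := ((i.+1 * n + m) %/ m.+1)%N; set lo := ((i * n + m) %/ m.+1)%N.
have lh : (lo <= hi)%N by apply: leq_div2r; lia.
have := divn_dist R (i.+1 * n + m) (ltn0Sn m).
have := divn_dist R (i * n + m) (ltn0Sn m).
rewrite -/hi -/lo => h1 h2.
have -> : m.+1%:R^-1 - (hi - lo)%:R / n%:R =
  ((lo%:R - (i * n + m)%:R / m.+1%:R) - (hi%:R - (i.+1 * n + m)%:R / m.+1%:R))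
   / n%:R :> R.
  rewrite natrB // [in RHS]mulSn !natrD !natrM; field.
  by rewrite !gt_eqF.
rewrite normrM (ger0_norm (x := n%:R^-1)) ?invr_ge0 //.
rewrite ler_pdivrMr // (le_trans (ler_normB _ _)) //.
move: n1; rewrite ler_pdivrMr // mulrC => n1; apply: le_trans n1; lra.
Unshelve. all: by end_near. Qed.

(** The powers of 1/n are distributed over the binomials, and the limit exp(-1) of the remaining
    factor is the product of the m+1 factors exp(-1/(m+1)) of the Poisson weights. *)
Lemma cvg_block_law m (v : 'I_m.+1 -> nat) :
  let s := (\sum_i v i)%N in
  n%:R^-1 ^+ s * (1 - n%:R^-1) ^+ (n - s) *
    \prod_i 'C(#|fiber (@block m n) i|, v i)%:R @[n --> \oo] -->
  \prod_i poisson_pmf (m.+1%:R^-1 : R) (v i).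
Proof.
move=> s.
have -> : \prod_i poisson_pmf (m.+1%:R^-1 : R) (v i) =
  expR (- 1) * \prod_i (m.+1%:R^-1 ^+ v i / (v i)`!%:R).
  rewrite /poisson_pmf invr_gt0 ltr0n /= big_split /= mulrC; congr (_ * _).
  rewrite prodr_const card_ord -expRM_natl mulrN divff //.
have -> : (fun n => n%:R^-1 ^+ s * (1 - n%:R^-1) ^+ (n - s) *
    \prod_i 'C(#|fiber (@block m n) i|, v i)%:R) =
  (fun n => (1 - n%:R^-1) ^+ (n - s) *
    \prod_i ('C(#|fiber (@block m n) i|, v i)%:R / n%:R ^+ v i) : R).
  apply/funext => n; rewrite big_split /= [RHS]mulrCA [LHS]mulrC; congr (_ * _).
  rewrite mulrC; congr (_ * _).
  by rewrite /s exprVn prodfV prodrXr.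
apply: cvgM; first exact: cvg_exp_onem_sub.
apply: cvg_big => [|i _]; first exact: mul_continuous.
by apply: cvg_binomial; exact: cvg_card_fiber_block.
Qed.

End Limits.

(** * From random colorings to the product measure *)

Section FiniteUnions.
Context d (T : measurableType d) (R : realType) (P : probability T R).
Local Open Scope classical_set_scope.

Lemma measurable_finite_union (U : finType) (A : pred U) (F : U -> set T) :
  (forall u, measurable (F u)) -> measurable (\bigcup_(u in [set u | A u]) F u).
Proof.
by move=> mF; apply: fin_bigcup_measurable => // u _; exact: mF.
Qed.

Lemma probability_finite_union (U : finType) (A : pred U) (F : U -> set T) :
  (forall u, measurable (F u)) ->
  (forall u u' w, F u w -> F u' w -> u = u') ->
  P (\bigcup_(u in [set u | A u]) F u) = (\sum_(u | A u) P (F u))%E.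
Proof.
move=> mF dF; have -> : [set u | A u] = [set` enum A].
  by apply/seteqP; split=> u /=; rewrite mem_enum.
rewrite measure_fin_bigcup //; last by move=> u u' _ _ [w [/dF h /h]].
by rewrite -fsbig_seq ?enum_uniq // big_enum.
Qed.

End FiniteUnions.

Section ColoringLaw.
Context d (T : measurableType d) (R : realType) (P : probability T R).
Local Open Scope classical_set_scope.
Variables (c n : nat) (theta : 'I_c.-1 -> R) (phi : T -> {ffun 'I_n -> 'I_c}).
Hypothesis phiP : random_coloring P theta phi.

Lemma measurable_coloring f : measurable [set w | phi w = f].
Proof.
case: phiP => mphi _ _.
have -> : [set w | phi w = f] =
    \bigcap_(i in [set: 'I_n]) ((fun w => phi w i) @^-1` [set f i]).
  apply/seteqP; split=> [w <- i _ //|w h].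
  by apply/ffunP => i; exact: h.
by apply: fin_bigcap_measurable => // i _; exact: mphi.
Qed.

Lemma probability_coloring f :
  P [set w | phi w = f] = (mass (color_prob theta n) f)%:E.
Proof.
case: phiP => _ lawphi /(_ [set: 'I_n]%SET (fun i => [set f i])) indep.
have -> : [set w | phi w = f] =
    \bigcap_(i in [set` [set: 'I_n]%SET]) ((fun w => phi w i) @^-1` [set f i]).
  apply/seteqP; split=> [w <- i _ //|w h].
  by apply/ffunP => i; apply: h; rewrite /= inE.
rewrite indep /mass -prodEFin; apply: eq_big => [i|i _]; first by rewrite inE.
by rewrite -(lawphi i).
Qed.

Lemma coloring_event (A : pred {ffun 'I_n -> 'I_c}) :
  [set w | A (phi w)] = \bigcup_(f in [set f | A f]) [set w | phi w = f].
Proof.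
by apply/seteqP; split=> [w Aw|w [f /= Af ->] //]; exists (phi w).
Qed.

Lemma measurable_coloring_event (A : pred {ffun 'I_n -> 'I_c}) :
  measurable [set w | A (phi w)].
Proof.
rewrite coloring_event; apply: measurable_finite_union.
exact: measurable_coloring.
Qed.

(** This replaces the abstract probability spaces by finite sums over colorings. *)
Lemma coloring_law (A : pred {ffun 'I_n -> 'I_c}) :
  P [set w | A (phi w)] =
  (expect (color_prob theta n) (fun f => (A f)%:R))%:E.
Proof.
rewrite coloring_event probability_finite_union; first last.
- by move=> f f' w /= <-.
- exact: measurable_coloring.
rewrite /expect -sumEFin big_mkcond /=; apply: eq_bigr => f _.
by case: (A f); rewrite ?mulr1 ?mulr0 // probability_coloring.
Qed.

(** For the last color the defining difference is not visibly nonnegative, but it is the probability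
    of an event about the first element of [n]. *)
Lemma color_prob_ge0 b : (0 < n)%N -> 0 <= color_prob theta n b.
Proof.
move=> n0; case: phiP => _ lawphi _.
by rewrite -lee_fin -(lawphi (Ordinal n0)) measure_ge0.
Qed.

Lemma color_prob_sum1 : (0 < n)%N -> \sum_b color_prob theta n b = 1.
Proof.
move=> n0; case: phiP => mphi lawphi _.
apply: EFin_inj; rewrite -sumEFin -(@probability_setT _ _ _ P).
rewrite (eq_bigr _ (fun b _ => esym (lawphi (Ordinal n0) b))).
rewrite -probability_finite_union; first last.
- by move=> b b' w /= <-.
- by move=> b; exact: (mphi _ [set b]).
by congr (P _); apply/seteqP; split=> // w _; exists (phi w (Ordinal n0)).
Qed.

End ColoringLaw.

(** * The Poisson process *)

Section Cells.
Variables (R : realType) (m : nat).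
Local Open Scope classical_set_scope.

(** The last cell is closed on the right, so that the cells partition [0, 1]. *)
Definition cell (i : 'I_m.+1) : interval R :=
  Interval (BLeft (i%:R / m.+1%:R))
    (if i == ord_max then BRight 1 else BLeft (i.+1%:R / m.+1%:R)).

(** On [0, 1] the cap at [m] matters only for x = 1. *)
Definition cell_of (x : R) : 'I_m.+1 :=
  inord (minn (Num.truncn (x * m.+1%:R)) m).

Lemma mem_cell x i : 0 <= x <= 1 -> (x \in cell i) = (cell_of x == i).
Proof.
move=> /andP[x0 x1].
have xm0 : 0 <= x * m.+1%:R by rewrite mulr_ge0.
have -> : (cell_of x == i) = (minn (Num.truncn (x * m.+1%:R)) m == i).
  by rewrite -val_eqE /= inordK // ltnS geq_minr.
rewrite in_itv /= ler_pdivrMr // -truncn_ge_nat //.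
have lti := ltn_ord i; case: eqVneq => [->|im] /=.
  by rewrite x1 andbT; move: (Num.truncn _) => t; lia.
rewrite ltr_pdivlMr // -truncn_lt_nat //.
have {}im : (i : nat) != m by [].
by move: (Num.truncn _) => t; lia.
Qed.

Lemma cell_sub i : [set` cell i] `<=` `[0, 1].
Proof.
move=> x; rewrite /= in_itv /= => /andP[ix xi]; rewrite in_itv /=.
rewrite (le_trans _ ix) ?divr_ge0 //=; move: xi.
case: eqVneq => [_|im] /= // h; apply: le_trans (ltW h) _.
by rewrite ler_pdivrMr // mul1r ler_nat.
Qed.

Lemma lebesgue_measure_cell i :
  lebesgue_measure [set` cell i] = (m.+1%:R^-1)%:E.
Proof.
have len b : b = i.+1%:R / m.+1%:R ->
    (if ((i%:R / m.+1%:R)%:E < b%:E)%E then (b%:E - (i%:R / m.+1%:R)%:E)%E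
     else 0%E) = (m.+1%:R^-1 : R)%:E.
  move=> ->; rewrite lte_fin ltr_pM2r ?invr_gt0 // ltr_nat ltnSn -EFinB -mulrBl.
  by rewrite -natr1 addrAC subrr add0r mul1r.
rewrite lebesgue_measure_itv /=; case: eqVneq => [im|_] /=; apply: len => //.
by rewrite im /= divff // pnatr_eq0.
Qed.

Lemma trivIset_cell : trivIset setT (fun i => [set` cell i]).
Proof.
move=> i j _ _ [x [/= xi xj]].
have x01 : 0 <= x <= 1 by have := cell_sub xi; rewrite /= in_itv.
by move: xi xj; rewrite !mem_cell // => /eqP-> /eqP.
Qed.

Lemma cell_of_dist x : 0 <= x <= 1 ->
  `|x - (cell_of x)%:R / m.+1%:R| <= m.+1%:R^-1.
Proof.
move=> x01; have := mem_cell (cell_of x) x01.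
rewrite eqxx in_itv /= => /andP[ix xi].
rewrite ger0_norm ?subr_ge0 // lerBlDr -[X in X + _]mul1r -mulrDl nat1r.
move: xi; case: eqVneq => [->|_] /=; last exact: ltW.
by rewrite divff // pnatr_eq0.
Qed.

Definition cell_counts (S : set R) : {ffun 'I_m.+1 -> nat} :=
  [ffun i => #|` fset_set (S `&` [set` cell i])|].

Variable S : set R.
Hypotheses (finS : finite_set S) (S01 : S `<=` `[0, 1]).

Lemma cell_countsE i :
  cell_counts S i = (\sum_(x <- fset_set S | cell_of x == i) 1)%N.
Proof.
rewrite ffunE card_fset_sum1 -fsbig_finite; last exact: finite_setIl.
rewrite fsbig_mkcondr fsbig_finite // [RHS]big_mkcond /=.
rewrite big_seq [RHS]big_seq; apply: eq_bigr => x.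
rewrite in_fset_set // inE => /S01; rewrite /= in_itv /= => x01.
rewrite -(mem_cell i x01); congr (if _ then _ else _).
by apply/idP/idP => [|h]; rewrite inE.
Qed.

Lemma sum_cell_counts : (\sum_i cell_counts S i)%N = #|` fset_set S|.
Proof.
rewrite card_fset_sum1 [RHS](partition_big cell_of predT) //=.
by apply: eq_bigr => i _; exact: cell_countsE.
Qed.

(** Moving a point to the left end of its cell changes [h] by at most 1/(m+1). *)
Lemma sum_cell_counts_dist (h : R -> R) :
  (forall x y, `|h x - h y| <= `|x - y|) ->
  `|\sum_(x \in S) h x -
    \sum_i (cell_counts S i)%:R * h (i%:R / m.+1%:R)| <=
  (#|` fset_set S|)%:R / m.+1%:R.
Proof.
move=> lip; rewrite fsbig_finite //.
have -> : \sum_i (cell_counts S i)%:R * h (i%:R / m.+1%:R) =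
    \sum_(x <- fset_set S) h ((cell_of x)%:R / m.+1%:R).
  rewrite (partition_big cell_of predT) //=; apply: eq_bigr => i _.
  rewrite cell_countsE natr_sum mulr_suml.
  by apply: eq_bigr => x /eqP->; rewrite mul1r.
rewrite -sumrB (le_trans (ler_norm_sum _ _ _)) //.
rewrite card_fset_sum1 natr_sum mulr_suml big_seq [leRHS]big_seq.
apply: ler_sum => x; rewrite in_fset_set // inE => /S01.
rewrite /= in_itv /= => x01; rewrite mul1r.
by apply: le_trans (lip _ _) (cell_of_dist x01).
Qed.

End Cells.

Section PoissonCounts.
Context d (T : measurableType d) (R : realType) (Q : probability T R).
Local Open Scope classical_set_scope.
Variable (PP : T -> set R).
Hypothesis PPP : poisson_point_process Q 1 `[0, 1] PP.
Variable m : nat.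

Lemma measurable_cell_counts (v : {ffun 'I_m.+1 -> nat}) :
  measurable [set w | cell_counts m (PP w) = v].
Proof.
case: PPP => _ law _.
have -> : [set w | cell_counts m (PP w) = v] =
    \bigcap_(i in [set: 'I_m.+1])
      (count_in PP [set` cell R i] @^-1` [set v i]).
  apply/seteqP; split=> [w <- i _|w h]; first by rewrite /= ffunE.
  by apply/ffunP => i; rewrite ffunE; exact: h.
apply: fin_bigcap_measurable => // i _.
by have [] := law _ (measurable_itv (cell R i)) (@cell_sub R m i).
Qed.

Lemma cell_counts_law (v : {ffun 'I_m.+1 -> nat}) :
  Q [set w | cell_counts m (PP w) = v] =
  (\prod_i poisson_pmf (m.+1%:R^-1 : R) (v i))%:E.
Proof.
case: PPP => _ law /(_ m.+1 (fun i => [set` cell R i])) indep.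
have {}indep := indep (fun i => conj (measurable_itv (cell R i))
  (@cell_sub R m i)) (@trivIset_cell R m).
have -> : [set w | cell_counts m (PP w) = v] =
    \bigcap_(i in [set` [set: 'I_m.+1]%SET])
      (count_in PP [set` cell R i] @^-1` [set v i]).
  apply/seteqP; split=> [w <- i _|w h]; first by rewrite /= ffunE.
  by apply/ffunP => i; rewrite ffunE; apply: h; rewrite /= inE.
rewrite indep -prodEFin; apply: eq_big => [i|i _]; first by rewrite inE.
have [_ ->] := law _ (measurable_itv (cell R i)) (@cell_sub R m i).
rewrite lebesgue_measure_cell /= mul1r /poisson_prob invr_gt0 ltr0n /=.
by rewrite esum_set1 // lee_fin poisson_pmf_ge0.
Qed.

Lemma measurable_cell_sum (h : R -> R) :
  measurable_fun setT (fun w =>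
    \sum_i (cell_counts m (PP w) i)%:R * h (i%:R / m.+1%:R)).
Proof.
apply: measurable_sum => i; apply: measurable_funM => // _ Y mY.
case: PPP => _ law _.
(* The preimage of [Y] is the event that the count lies in a set of naturals, which is measurable as
   the count is discrete. *)
have [/(_ [set k : nat | Y k%:R]) mlaw _] :=
  law _ (measurable_itv (cell R i)) (@cell_sub R m i).
rewrite setTI [X in measurable X](_ : _ = count_in PP [set` cell R i] @^-1`
  [set k : nat | Y k%:R]) //.
by apply/seteqP; split=> w /=; rewrite ffunE.
Qed.

End PoissonCounts.

(** * Events on counts bounded by a constant *)

Section BoundedEvents.
Variables (m K : nat) (Phi : pred {ffun 'I_m.+1 -> nat}).
Hypothesis PhiK : forall v, Phi v -> forall i, (v i <= K)%N.

(** Bounded count vectors form a finite type, over which events decompose into finite unions and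
    probabilities into finite sums. *)
Definition nat_vector (v : {ffun 'I_m.+1 -> 'I_K.+1}) : {ffun 'I_m.+1 -> nat} :=
  [ffun i => v i : nat].

Lemma nat_vector_inj : injective nat_vector.
Proof.
move=> v v' /ffunP e; apply/ffunP => i; apply/val_inj.
by have := e i; rewrite !ffunE.
Qed.

Lemma nat_vectorP v : Phi v -> exists u, nat_vector u = v.
Proof.
move=> Pv; exists [ffun i => inord (v i)]; apply/ffunP => i.
by rewrite !ffunE inordK // ltnS PhiK.
Qed.

Lemma sum_nat_vector (R : pzSemiRingType) (b : {ffun 'I_m.+1 -> nat}) :
  \sum_(v | Phi (nat_vector v)) (b == nat_vector v)%:R = (Phi b)%:R :> R.
Proof.
case: (boolP (Phi b)) => [Pb|nPb].
  have [u ub] := nat_vectorP Pb.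
  rewrite (bigD1 u) ?ub //= eqxx big1 ?addr0 // => v /andP[_ vu].
  by rewrite -ub (inj_eq nat_vector_inj) eq_sym (negbTE vu).
by rewrite big1 // => v; case: eqP => // <-; rewrite (negbTE nPb).
Qed.

End BoundedEvents.

Definition block_counts (m n : nat) (A : {set 'I_n}) : {ffun 'I_m.+1 -> nat} :=
  [ffun i => block_count (@block m n) A i].

Section PoissonLimit.
Context d (T : measurableType d) (R : realType) (Q : probability T R).
Local Open Scope classical_set_scope.
Variable (PP : T -> set R).
Hypothesis PPP : poisson_point_process Q 1 `[0, 1] PP.

Lemma finite_points w : finite_set (PP w).
Proof. by case: PPP => /(_ w)[]. Qed.

Lemma points_sub w : PP w `<=` `[0, 1].
Proof. by case: PPP => /(_ w)[]. Qed.

(** The process is given through its counts only, so the sum is obtained as the pointwise limit of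
    the measurable cell sums. *)
Lemma measurable_sum_points (h : R -> R) :
  (forall x y, `|h x - h y| <= `|x - y|) ->
  measurable_fun setT (fun w => \sum_(x \in PP w) h x).
Proof.
move=> lip; apply: (@measurable_fun_cvg _ _ _ _ (fun m w =>
    \sum_i (cell_counts m (PP w) i)%:R * h (i%:R / m.+1%:R))).
  by move=> m; exact: (measurable_cell_sum PPP).
move=> w _; apply/cvgrPdist_le => e e0; near=> m.
apply: le_trans
  (sum_cell_counts_dist m (finite_points w) (@points_sub w) lip) _.
rewrite ler_pdivrMr // mulrC -ler_pdivrMr //.
apply: (@le_trans _ _ m%:R); last by rewrite ler_nat.
by near: m; exact: nbhs_infty_ger.
Unshelve. all: by end_near. Qed.

Section Event.
Variables (m K : nat) (Phi : pred {ffun 'I_m.+1 -> nat}).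
Hypothesis PhiK : forall v, Phi v -> forall i, (v i <= K)%N.

Lemma cell_counts_eventE :
  [set w | Phi (cell_counts m (PP w))] =
  \bigcup_(v in [set v : {ffun 'I_m.+1 -> 'I_K.+1} | Phi (nat_vector v)])
    [set w | cell_counts m (PP w) = nat_vector v].
Proof.
apply/seteqP; split=> [w /= Pw|w [v /= Pv ->] //].
by have [u e] := nat_vectorP PhiK Pw; exists u; rewrite /= ?e.
Qed.

Lemma measurable_cell_counts_event :
  measurable [set w | Phi (cell_counts m (PP w))].
Proof.
rewrite cell_counts_eventE; apply: measurable_finite_union => v.
exact: (measurable_cell_counts PPP).
Qed.

Lemma cell_counts_event_law :
  Q [set w | Phi (cell_counts m (PP w))] =
  (\sum_(v : {ffun 'I_m.+1 -> 'I_K.+1} | Phi (nat_vector v))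
    \prod_i poisson_pmf (m.+1%:R^-1 : R) (v i))%:E.
Proof.
rewrite cell_counts_eventE probability_finite_union; first last.
- by move=> v v' w /= -> /nat_vector_inj.
- by move=> v; exact: (measurable_cell_counts PPP).
rewrite -sumEFin; apply: eq_bigr => v _; rewrite (cell_counts_law PPP).
by congr EFin; apply: eq_bigr => i _; rewrite ffunE.
Qed.

(** Both probabilities are sums over the same finite set of count vectors, so the convergence of
    each term suffices. *)
Lemma cvg_block_event c (p : nat -> 'I_c -> R) (b0 : 'I_c) :
  (\forall n \near \oo, \sum_j p n j = 1 /\ p n b0 = n%:R^-1) ->
  expect (p n) (fun f : {ffun 'I_n -> 'I_c} =>
    (Phi (block_counts m (rare_set b0 f)))%:R) @[n --> \oo]
  --> fine (Q [set w | Phi (cell_counts m (PP w))]).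
Proof.
move=> pP; rewrite cell_counts_event_law /=.
have h : \sum_(v : {ffun 'I_m.+1 -> 'I_K.+1} | Phi (nat_vector v))
    (n%:R^-1 ^+ (\sum_i v i) * (1 - n%:R^-1) ^+ (n - \sum_i v i) *
    \prod_i 'C(#|fiber (@block m n) i|, v i)%:R) @[n --> \oo] -->
  (\sum_(v : {ffun 'I_m.+1 -> 'I_K.+1} | Phi (nat_vector v))
    \prod_i poisson_pmf (m.+1%:R^-1 : R) (v i)).
  apply: cvg_big => [|v _]; first exact: add_continuous.
  exact: (cvg_block_law (v := fun i => v i)).
apply: cvg_trans h; apply: near_eq_cvg; near=> n.
have [p1 pb] : \sum_j p n j = 1 /\ p n b0 = n%:R^-1 by near: n.
transitivity (expect (p n) (fun f : {ffun 'I_n -> 'I_c} =>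
    \sum_(v : {ffun 'I_m.+1 -> 'I_K.+1} | Phi (nat_vector v))
    (block_counts m (rare_set b0 f) == nat_vector v)%:R)); last first.
  by apply: eq_expect => f; rewrite sum_nat_vector.
rewrite expect_sum; apply: eq_bigr => v _; rewrite -pb.
rewrite -(expect_block_count p1 b0 (@block m n) (fun i => v i)).
apply: eq_expect => f; congr (nat_of_bool _)%:R; apply/forallP/eqP => e.
  by apply/ffunP => i; rewrite !ffunE; apply/eqP.
by move=> i; have /ffunP/(_ i) := e; rewrite !ffunE => ->.
Unshelve. all: by end_near. Qed.

End Event.

End PoissonLimit.

(** * Comparison of the distribution functions *)

Section FiniteBounds.
Variables (R : realType) (c r n : nat) (p : 'I_c -> R).
Hypothesis p_ge0 : forall j, 0 <= p j.
Hypothesis p_sum1 : \sum_j p j = 1.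
Variables (a : {ffun 'I_r -> 'I_c}) (s0 : 'I_r).
Hypothesis r_gt1 : (1 < r)%N.
Hypothesis np1 : n%:R * p (a s0) = 1.
Notation coloring := {ffun 'I_n -> 'I_c}.
Implicit Type f : coloring.
Local Notation rare f := (rare_set (a s0) f).
Local Notation lam := (@lambda R r s0.+1).

(** Markov's inequality. With [tau] the square root of n q, the expected distance is of order [tau],
    while the normalization is [tau ^+ 2]; the constant uses 1/tau <= 1 <= tau. *)
Lemma expect_colorful_tail (tau e : R) : 1 <= tau -> 0 < e ->
  n%:R * companion_prob p a s0 = tau ^+ 2 ->
  expect p (fun f => (e < `|(num_colorful_AP f a)%:R / tau ^+ 2 -
                           rare_sum R a s0 f|)%R%:R) <=
  (5 + (r * r)%:R) / e * tau^-1.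
Proof.
move=> tau1 e0 tauE; have tau0 : 0 < tau by apply: lt_le_trans tau1.
have t20 : 0 < tau ^+ 2 by rewrite exprn_gt0.
apply: le_trans (markov_expect p_ge0 e0 (fun f => normr_ge0 _)) _.
rewrite (mulrAC _ e^-1) ler_pM2r ?invr_gt0 //.
rewrite (@eq_expect _ _ _ _ _ (fun f => (tau ^+ 2)^-1 *
  `|(num_colorful_AP f a)%:R - tau ^+ 2 * rare_sum R a s0 f|)); last first.
  move=> f; rewrite -[X in _ = X * _]gtr0_norm ?invr_gt0 // -normrM; congr `|_|.
  by field; rewrite gt_eqF.
rewrite expectZ -tauE.
have := expect_dist_num_colorful p_ge0 p_sum1 r_gt1 np1 tau0.
rewrite tauE => h; rewrite ler_pdivrMl //; apply: le_trans h _.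
have -> : tau ^+ 2 * ((5 + (r * r)%:R) / tau) = 5 * tau + (r * r)%:R * tau.
  by field; rewrite gt_eqF.
have -> : (tau + (4 + (r * r)%:R * tau ^+ 2) / tau) / 2 =
  (tau + 4 * tau^-1 + (r * r)%:R * tau) / 2 by field; rewrite gt_eqF.
have i1 : tau^-1 <= 1 by rewrite invf_le1.
have : 0 <= (r * r)%:R * tau by rewrite mulr_ge0 // ltW.
lra.
Qed.

(** The expected number of rare elements is 1, and Markov's inequality applies. *)
Lemma expect_card_rare_tail K : (0 < K)%N ->
  expect p (fun f => (K < #|rare f|)%N%:R) <= K%:R^-1.
Proof.
move=> K0; have K0' : 0 < K%:R :> R by rewrite ltr0n.
rewrite (@eq_expect _ _ _ _ _ (fun f => (K%:R < #|rare f|%:R :> R)%R%:R));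
  last by move=> f; rewrite ltr_nat.
apply: le_trans (markov_expect p_ge0 K0' (fun f => ler0n _ _)) _.
rewrite (@eq_expect _ _ _ _ _ (fun f => \sum_k rare_at R a s0 k f)).
  rewrite expect_sum (eq_bigr (fun=> p (a s0))); last first.
    by move=> k _; rewrite expect_rare.
  by rewrite sumr_const card_ord -[X in X / _]mulr_natl np1 mul1r.
move=> f; rewrite -sum1_card natr_sum big_mkcond /=; apply: eq_bigr => k _.
by rewrite inE /rare_at; case: (f k == a s0).
Qed.

(** The discrete analogue of [sum_cell_counts_dist]: each k/n is moved to the left end of its
    block. *)
Lemma rare_sum_dist m f :
  `|rare_sum R a s0 f -
    \sum_i (block_counts m (rare f) i)%:R * lam (i%:R / m.+1%:R)| <=
  #|rare f|%:R / m.+1%:R.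
Proof.
have -> : rare_sum R a s0 f = \sum_(k in rare f) lam (k%:R / n%:R).
  rewrite [RHS]big_mkcond; apply: eq_bigr => k _; rewrite inE /rare_at.
  by case: eqP; rewrite ?mul1r ?mul0r.
have -> : \sum_i (block_counts m (rare f) i)%:R * lam (i%:R / m.+1%:R) =
    \sum_(k in rare f) lam ((block m k)%:R / m.+1%:R).
  rewrite [RHS](partition_big (@block m n) predT) //=; apply: eq_bigr => i _.
  rewrite ffunE /block_count -sum1_card natr_sum mulr_suml.
  apply: eq_big => [k|k]; first by rewrite !inE.
  by rewrite !inE => /andP[_ /eqP->]; rewrite mul1r.
rewrite -sumrB (le_trans (ler_norm_sum _ _ _)) //.
rewrite -sum1_card natr_sum mulr_suml; apply: ler_sum => k _.
rewrite mul1r; apply: le_trans (block_dist R m k).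
by apply: lambda_lipschitz => //; rewrite ltn_ord.
Qed.

End FiniteBounds.

Definition few_points (m K : nat) : pred {ffun 'I_m.+1 -> nat} :=
  fun v => (\sum_i v i <= K)%N.

(** The approximation of the event that the sum is at most [z] by one depending on the counts only;
    the cutoff [K] leaves finitely many count vectors. *)
Definition low_sum (R : realType) (h : R -> R) (m K : nat) (z : R) :
    pred {ffun 'I_m.+1 -> nat} :=
  fun v => few_points K v && (\sum_i (v i)%:R * h (i%:R / m.+1%:R) <= z).

Lemma few_points_le m K (v : {ffun 'I_m.+1 -> nat}) :
  few_points K v -> forall i, (v i <= K)%N.
Proof. by move=> h i; apply: leq_trans h; rewrite (bigD1 i) //= leq_addr. Qed.

Lemma low_sum_le (R : realType) (h : R -> R) m K z v :
  @low_sum R h m K z v -> forall i, (v i <= K)%N.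
Proof. by move=> /andP[/few_points_le]. Qed.

Section Comparison.
Variables (R : realType) (c r n : nat) (p : 'I_c -> R).
Hypothesis p_ge0 : forall j, 0 <= p j.
Hypothesis p_sum1 : \sum_j p j = 1.
Variables (a : {ffun 'I_r -> 'I_c}) (s0 : 'I_r).
Hypothesis r_gt1 : (1 < r)%N.
Variables (A y e : R) (m K : nat).
Notation coloring := {ffun 'I_n -> 'I_c}.
Implicit Type f : coloring.
Local Notation rare f := (rare_set (a s0) f).
Local Notation lam := (@lambda R r s0.+1).
Local Notation far f :=
  (e < `|(num_colorful_AP f a)%:R / A - rare_sum R a s0 f|).
Local Notation low z f := (low_sum lam K z (block_counts m (rare f))).

Lemma near_dist (x w u N k : R) : `|x - w| <= e -> `|w - u| <= N -> N <= k ->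
  `|x - u| <= e + k.
Proof.
move=> xw wu Nk.
by apply: le_trans (ler_distD w _ _) (lerD xw (le_trans wu Nk)).
Qed.

Lemma few_points_rare f :
  few_points K (block_counts m (rare f)) = ~~ (K < #|rare f|)%N.
Proof.
rewrite -leqNgt -(sum_block_count (@block m n)) /few_points.
by congr (_ <= _)%N; apply: eq_bigr => i _; rewrite ffunE.
Qed.

(** Apart from the two exceptional events, the normalized count and the block sum differ by at most
    e + K/(m+1). *)
Lemma colorful_cdf_le :
  expect p (fun f => ((num_colorful_AP f a)%:R / A <= y)%R%:R) <=
  expect p (fun f => (far f)%:R) + expect p (fun f => (K < #|rare f|)%N%:R) +
  expect p (fun f => (low (y + e + K%:R / m.+1%:R) f)%:R).
Proof.
rewrite -!expectD; apply: expect_le => // f.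
case: ltP => [_|near_f].
  rewrite -addrA; case: (_ <= y); first by rewrite lerDl addr_ge0.
  by rewrite !addr_ge0.
rewrite add0r /low_sum few_points_rare.
case: (ltnP K #|rare f|) => [_|few] /=.
  by rewrite addr0; case: (_ <= y).
rewrite add0r; case: (lerP _ y) => // le_y.
rewrite (_ : (_ <= _ + _) = true) //; apply/eqP; rewrite eqb_id.
have dist := rare_sum_dist R a s0 r_gt1 m f.
have NK : #|rare f|%:R / m.+1%:R <= K%:R / m.+1%:R :> R.
  by rewrite ler_pM2r ?invr_gt0 // ler_nat.
have := near_dist near_f dist NK; rewrite ler_distlC => /andP[d1 d2].
by apply: le_trans d2 _; rewrite addrA !lerD2r.
Qed.

(** [low_sum] already includes the cutoff on the number of rare elements, so only [far] is
    exceptional here. *)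
Lemma colorful_cdf_ge :
  expect p (fun f => (low (y - e - K%:R / m.+1%:R) f)%:R) <=
  expect p (fun f => ((num_colorful_AP f a)%:R / A <= y)%R%:R) +
  expect p (fun f => (far f)%:R).
Proof.
rewrite -!expectD; apply: expect_le => // f.
case: ltP => [_|near_f].
  by case: (low _ f); rewrite ?lerDr // addr_ge0.
rewrite addr0 /low_sum few_points_rare -leqNgt.
case: (leqP #|rare f| K) => //= few; case: (lerP _ (_ - _)) => // le_y.
rewrite (_ : (_ <= y) = true) //; apply/eqP; rewrite eqb_id.
have dist := rare_sum_dist R a s0 r_gt1 m f.
have NK : #|rare f|%:R / m.+1%:R <= K%:R / m.+1%:R :> R.
  by rewrite ler_pM2r ?invr_gt0 // ler_nat.
have := near_dist near_f dist NK; rewrite ler_distl => /andP[d1 d2].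
by apply: le_trans d2 _; rewrite -lerBrDr opprD addrA.
Qed.

Lemma expect_few_points :
  1 <= expect p (fun f => (K < #|rare f|)%N%:R) +
       expect p (fun f => (few_points K (block_counts m (rare f)))%:R).
Proof.
rewrite -[leLHS](expect1 'I_n p_sum1) -expectD; apply: expect_le => // f.
by rewrite few_points_rare; case: (K < _)%N; rewrite ?addr0 ?add0r.
Qed.

End Comparison.

Section LimitCDF.
Context d (T : measurableType d) (R : realType) (Q : probability T R).
Local Open Scope classical_set_scope.
Variables (PP : T -> set R) (h : R -> R).
Hypothesis PPP : poisson_point_process Q 1 `[0, 1] PP.
Hypothesis lip : forall x y, `|h x - h y| <= `|x - y|.

Definition point_sum (w : T) : R := \sum_(x \in PP w) h x.

Definition point_cdf (z : R) : R := fine (Q [set w | point_sum w <= z]).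

Lemma measurable_point_sum_le z : measurable [set w | point_sum w <= z].
Proof.
have := measurable_sum_points PPP lip; rewrite -/point_sum => mf.
have -> : [set w | point_sum w <= z] = setT `&` point_sum @^-1` `]-oo, z].
  by rewrite setTI; apply/seteqP; split=> w /=; rewrite in_itv.
by apply: mf => //; exact: measurable_itv.
Qed.

Lemma le_fine_probability (X Y : set T) : measurable X -> measurable Y ->
  X `<=` Y -> fine (Q X) <= fine (Q Y).
Proof.
move=> mX mY XY; apply: fine_le; rewrite ?fin_num_measure //.
by apply: le_measure; rewrite ?inE.
Qed.

Lemma point_sum_dist m K w : few_points K (cell_counts m (PP w)) ->
  `|point_sum w - \sum_i (cell_counts m (PP w) i)%:R * h (i%:R / m.+1%:R)| <=
  K%:R / m.+1%:R.
Proof.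
have fin := finite_points PPP w; have sub := @points_sub _ _ _ _ _ PPP w.
rewrite /few_points (sum_cell_counts m fin sub) => few.
apply: le_trans (sum_cell_counts_dist m fin sub lip) _.
by rewrite ler_pM2r ?invr_gt0 // ler_nat.
Qed.

Lemma low_sum_cdf_le m K z :
  fine (Q [set w | low_sum h K z (cell_counts m (PP w))]) <=
  point_cdf (z + K%:R / m.+1%:R).
Proof.
apply: le_fine_probability.
- exact: (measurable_cell_counts_event PPP (@low_sum_le _ h m K z)).
- exact: measurable_point_sum_le.
move=> w /= /andP[/point_sum_dist]; rewrite ler_distl => /andP[_ d2] le_z.
by apply: le_trans d2 _; rewrite lerD2r.
Qed.

(** The last term accounts for the outcomes with more than [K] points, which [low_sum] discards. *)
Lemma low_sum_cdf_ge m K z :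
  point_cdf (z - K%:R / m.+1%:R) <=
  fine (Q [set w | low_sum h K z (cell_counts m (PP w))]) +
  (1 - fine (Q [set w | few_points K (cell_counts m (PP w))])).
Proof.
have mL := measurable_cell_counts_event PPP (@low_sum_le _ h m K z).
have mF := measurable_cell_counts_event PPP (@few_points_le m K).
have -> : 1 - fine (Q [set w | few_points K (cell_counts m (PP w))]) =
    fine (Q (~` [set w | few_points K (cell_counts m (PP w))])).
  by rewrite probability_setC // fineB // fin_num_measure.
rewrite -fineD ?fin_num_measure //; last exact: measurableC.
apply: fine_le.
- by rewrite fin_num_measure //; exact: measurable_point_sum_le.
- by rewrite fin_numD !fin_num_measure //; exact: measurableC.
apply: le_trans (measureU2 _ mL (measurableC mF)).
apply: le_measure; rewrite ?inE.
- exact: measurable_point_sum_le.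
- by apply: measurableU => //; exact: measurableC.
move=> w /= le_z.
have [few|nfew] := boolP (few_points K (cell_counts m (PP w))); last first.
  by right; exact/negP.
left; rewrite /low_sum few /=; move: (point_sum_dist few).
rewrite ler_distlC => /andP[_ d2]; apply: le_trans d2 _.
by rewrite -lerBrDr.
Qed.

End LimitCDF.

Local Open Scope classical_set_scope.
Local Open Scope ring_scope.

Lemma squeeze_cdf (R : realType) (u : nat -> R) (F : R -> R) (y : R) :
  {for y, continuous F} ->
  (forall e : R, 0 < e -> \forall n \near \oo,
    F (y - e) - e <= u n <= F (y + e) + e) ->
  u @ \oo --> F y.
Proof.
move=> cF uF; apply/cvgrPdist_le => e e0.
have /cvgrPdist_le/(_ (e / 2)) := cF; rewrite divr_gt0 // => /(_ isT).
move=> /nbhs_ballP[dl /= dl0 Fdl].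
(* The shift must stay within the modulus of continuity, and the additive error within the half of
   [e] that continuity leaves. *)
pose e' := Num.min (dl / 2) (e / 2).
have e'0 : 0 < e' by rewrite lt_min !divr_gt0.
have e'dl : e' < dl by rewrite gt_min; apply/orP; left; lra.
have e'e : e' <= e / 2 by rewrite ge_min lexx orbT.
near=> n.
have /andP[u1 u2] : F (y - e') - e' <= u n <= F (y + e') + e'.
  by near: n; exact: uF.
have := Fdl (y + e'); rewrite /ball /= opprD addNKr normrN gtr0_norm //.
move=> /(_ e'dl); have := Fdl (y - e'); rewrite /ball /= opprB subrKC.
rewrite gtr0_norm // => /(_ e'dl).
rewrite !ler_norml => /andP[f1 f2] /andP[f3 f4]; lra.
Unshelve. all: by end_near. Qed.

(** * Color probabilities as powers of n *)

Section ColorProbabilities.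
Variables (R : realType) (c r : nat) (theta : 'I_c.-1 -> R).
Variable a : {ffun 'I_r -> 'I_c.-1}.

Lemma color_prob_palette n s :
  color_prob theta n (palette_of a s) = n%:R `^ (- theta (a s)).
Proof.
rewrite /color_prob ffunE (_ : insub _ = Some (a s)) //.
exact: (valK (a s)).
Qed.

(** The rare color has probability 1/n, so n q is n^2 times the product of all [r] color
    probabilities. *)
Lemma mul_companion_prob n s0 : (0 < n)%N -> theta (a s0) = 1 ->
  n%:R * companion_prob (color_prob theta n) (palette_of a) s0 =
  n%:R `^ (2 - weighted_theta theta a).
Proof.
move=> n0 th1; have nn0 : n%:R != 0 :> R by rewrite pnatr_eq0 -lt0n.
have prodE : \prod_s color_prob theta n (palette_of a s) =
    n%:R `^ (- weighted_theta theta a).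
  rewrite weighted_thetaE -sumrN.
  rewrite (big_morph (powR n%:R) (id1 := 1) (op1 := *%R)); first last.
  - exact: powRr0.
  - by move=> x y; rewrite powRD // nn0 implybT.
  by apply: eq_bigr => s _; rewrite color_prob_palette.
rewrite powRD ?nn0 ?implybT // -prodE (bigD1 s0) //= -/(companion_prob _ _ _).
rewrite color_prob_palette th1 powR_inv1 // powR_mulrn // mulrA.
by rewrite expr2 mulfK.
Qed.

End ColorProbabilities.

Lemma cvg_powR_inv (R : realType) (k : R) : 0 < k ->
  (n%:R `^ k)^-1 @[n --> \oo] --> (0 : R).
Proof.
move=> k0; apply/cvgrPdist_le => e e0; near=> n.
have n1 : e^-1 `^ k^-1 <= n%:R by near: n; exact: nbhs_infty_ger.
have : (e^-1 `^ k^-1) `^ k <= n%:R `^ k.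
  by apply: ge0_ler_powR; rewrite ?nnegrE ?powR_ge0 // ltW.
rewrite -powRrM mulVf ?gt_eqF // powRr1 ?invr_ge0 ?(ltW e0) // => le_n.
have np : 0 < n%:R `^ k by apply: lt_le_trans le_n; rewrite invr_gt0.
rewrite sub0r normrN ger0_norm ?invr_ge0 ?(ltW np) //.
by rewrite -[leRHS]invrK lef_pV2 ?posrE ?invr_gt0.
Unshelve. all: by end_near. Qed.

(** The arithmetic of the sandwich: [u] is the distribution function before the limit, [E1] and [E2]
    are block events, [G1] and [G2] their Poisson limits, and the [F]s values of the limiting
    distribution function. *)
Lemma cdf_bounds (R : realFieldType)
    (t u far rare few k G1 E1 G2 E2 F1 F2 F1' F2' : R) :
  u <= far + rare + E1 -> E2 <= u + far -> far <= t -> rare <= k ->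
  1 - k <= few -> k <= t -> E1 - t <= G1 -> G1 <= E1 + t ->
  E2 - t <= G2 -> G2 <= E2 + t -> G1 <= F1 -> F2 <= G2 + (1 - few) ->
  F1 <= F1' -> F2' <= F2 ->
  F2' - (t + t + t + t) <= u <= F1' + (t + t + t + t).
Proof. by move=> *; apply/andP; split; lra. Qed.

(** * Convergence of the distribution functions for the product measures *)

Section Convergence.
Variables (R : realType) (c r : nat) (hr : (3 <= r)%N).
Variables (a : {ffun 'I_r -> 'I_c.-1}) (theta : 'I_c.-1 -> R) (s0 : 'I_r).
Hypotheses (hsum : weighted_theta theta a < 2) (th1 : theta (a s0) = 1).
Local Notation p := (color_prob theta).
Local Notation b := (palette_of a).
Local Notation lam := (@lambda R r s0.+1).
Hypothesis p_prob : \forall n \near \oo,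
  (forall j, 0 <= p n j) /\ \sum_j p n j = 1.

Let r_gt1 : (1 < r)%N. Proof. exact: ltnW. Qed.

Lemma rare_probability n : p n (b s0) = n%:R^-1.
Proof. by rewrite color_prob_palette th1 powR_inv1. Qed.

Lemma colorful_far_cvg (e : R) : 0 < e -> \forall n \near \oo,
  expect (p n) (fun f : {ffun 'I_n -> 'I_c} =>
    (e < `|(num_colorful_AP f b)%:R / n%:R `^ (2 - weighted_theta theta a) -
           rare_sum R b s0 f|)%R%:R) <= e.
Proof.
(* Half the exponent: n^k is the square root of n q, and it tends to infinity since the weighted sum
   is below 2. *)
move=> e0; pose k : R := (2 - weighted_theta theta a) / 2.
have k0 : 0 < k by rewrite divr_gt0 // subr_gt0.
have C0 : (5 + (r * r)%:R) / e * (n%:R `^ k)^-1 @[n --> \oo] --> (0 : R).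
  rewrite -[X in _ --> X](mulr0 ((5 + (r * r)%:R) / e)).
  by apply: cvgM; [exact: cvg_cst|exact: cvg_powR_inv].
near=> n.
have n0 : (0 < n)%N by near: n; exact: nbhs_infty_gt.
have [p0 p1] : (forall j, 0 <= p n j) /\ \sum_j p n j = 1 by near: n.
have n1 : 1 <= n%:R :> R by rewrite ler1n.
have np1 : n%:R * p n (b s0) = 1.
  by rewrite rare_probability divff // pnatr_eq0 -lt0n.
have tau1 : 1 <= n%:R `^ k.
  by have := ler_powR n1 (ltW k0); rewrite powRr0.
have tauE : n%:R `^ (2 - weighted_theta theta a) = (n%:R `^ k) ^+ 2.
  by rewrite -powR_mulrn ?powR_ge0 // -powRrM /k mulfVK.
have := mul_companion_prob n0 th1; rewrite tauE => nq.
apply: le_trans (expect_colorful_tail p0 p1 r_gt1 np1 tau1 e0 nq) _.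
near: n.
have /cvgrPdist_le/(_ e e0) := C0; apply: filterS => n.
by rewrite sub0r normrN; apply: le_trans; exact: ler_norm.
Unshelve. all: by end_near. Qed.

Context d (T : measurableType d) (Q : probability T R) (PP : T -> set R).
Hypothesis PPP : poisson_point_process Q 1 `[0, 1] PP.

Let lip x y : `|lam x - lam y| <= `|x - y|.
Proof. by apply: lambda_lipschitz => //; rewrite ltn_ord. Qed.

Let rare_prob_near :
  \forall n \near \oo, \sum_j p n j = 1 /\ p n (b s0) = n%:R^-1.
Proof.
by apply: filterS p_prob => n [_ p1]; split=> //; exact: rare_probability.
Qed.

(** The Markov bound on the number of rare elements passes to the limit, so no Poisson tail has to
    be computed. *)
Lemma few_points_probability m K : (0 < K)%N ->
  1 - K%:R^-1 <= fine (Q [set w | few_points K (cell_counts m (PP w))]).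
Proof.
move=> K0; have cvg_few :=
  cvg_block_event PPP (@few_points_le m K) rare_prob_near.
apply: (ler_cvg_to (cvg_cst _) cvg_few); near=> n.
have n0 : (0 < n)%N by near: n; exact: nbhs_infty_gt.
have [p0 p1] : (forall j, 0 <= p n j) /\ \sum_j p n j = 1 by near: n.
have np1 : n%:R * p n (b s0) = 1.
  by rewrite rare_probability divff // pnatr_eq0 -lt0n.
have := expect_few_points n p0 p1 b s0 m K.
have := expect_card_rare_tail p0 p1 np1 K0.
by move=> h1 h2; rewrite lerBlDl; apply: le_trans h2 _; rewrite lerD2r.
Unshelve. all: by end_near. Qed.

Lemma cvg_colorful_cdf (y : R) :
  {for y, continuous (point_cdf Q PP lam)} ->
  expect (p n) (fun f : {ffun 'I_n -> 'I_c} =>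
    ((num_colorful_AP f b)%:R / n%:R `^ (2 - weighted_theta theta a) <= y)%R%:R)
    @[n --> \oo] --> point_cdf Q PP lam y.
Proof.
move=> cF; apply: squeeze_cdf cF _ => e e0.
have mono z z' : z <= z' -> point_cdf Q PP lam z <= point_cdf Q PP lam z'.
  move=> zz'; apply: le_fine_probability.
  - exact: (measurable_point_sum_le PPP lip).
  - exact: (measurable_point_sum_le PPP lip).
  - by move=> w /= h; exact: le_trans zz'.
(* First [K] is chosen with 1/K at most [t], then [m] with K/(m+1) at most [t]. The total shift t +
   2k is then at most 3t: [k] is paid once from colorings to blocks and once from cells to
   points. *)
pose t := e / 4; have t0 : 0 < t by rewrite divr_gt0.
pose K := (Num.truncn t^-1).+1.
have Kt : K%:R^-1 <= t.
  by rewrite -[leRHS]invrK lef_pV2 ?posrE ?invr_gt0 // ltW // truncnS_gt.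
pose m := Num.truncn (K%:R / t); pose k : R := K%:R / m.+1%:R.
have kt : k <= t.
  by rewrite ler_pdivrMr // mulrC -ler_pdivrMr // ltW // truncnS_gt.
have k0 : 0 <= k by rewrite divr_ge0.
have cvgG z := cvg_block_event PPP (@low_sum_le R lam m K z) rare_prob_near.
have few := few_points_probability m (ltn0Sn _ : (0 < K)%N).
near=> n.
have n0 : (0 < n)%N by near: n; exact: nbhs_infty_gt.
have [p0 p1] : (forall j, 0 <= p n j) /\ \sum_j p n j = 1 by near: n.
have np1 : n%:R * p n (b s0) = 1.
  by rewrite rare_probability divff // pnatr_eq0 -lt0n.
have up := @colorful_cdf_le R c r n (p n) p0 b s0 r_gt1
  (n%:R `^ (2 - weighted_theta theta a)) y t m K.
have dn := @colorful_cdf_ge R c r n (p n) p0 b s0 r_gt1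
  (n%:R `^ (2 - weighted_theta theta a)) y t m K.
have far : expect (p n) (fun f : {ffun 'I_n -> 'I_c} =>
    (t < `|(num_colorful_AP f b)%:R / n%:R `^ (2 - weighted_theta theta a) -
           rare_sum R b s0 f|)%R%:R) <= t.
  by near: n; exact: colorful_far_cvg.
have rt := expect_card_rare_tail p0 p1 np1 (ltn0Sn _ : (0 < K)%N).
have e1 : `|fine (Q [set w | low_sum lam K (y + t + k)
    (cell_counts m (PP w))]) - expect (p n) (fun f : {ffun 'I_n -> 'I_c} =>
    (low_sum lam K (y + t + k) (block_counts m (rare_set (b s0) f)))%:R)| <= t.
  by near: n; move: (cvgG (y + t + k)) => /cvgrPdist_le; apply.
have e2 : `|fine (Q [set w | low_sum lam K (y - t - k)
    (cell_counts m (PP w))]) - expect (p n) (fun f : {ffun 'I_n -> 'I_c} =>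
    (low_sum lam K (y - t - k) (block_counts m (rare_set (b s0) f)))%:R)| <= t.
  by near: n; move: (cvgG (y - t - k)) => /cvgrPdist_le; apply.
have g1 := low_sum_cdf_le PPP lip m K (y + t + k).
have g2 := low_sum_cdf_ge PPP lip m K (y - t - k).
have m1 : point_cdf Q PP lam (y + t + k + k) <= point_cdf Q PP lam (y + e).
  by apply: mono; rewrite /t in kt *; lra.
have m2 : point_cdf Q PP lam (y - e) <= point_cdf Q PP lam (y - t - k - k).
  by apply: mono; rewrite /t in kt *; lra.
move: e1 e2; rewrite !ler_distl => /andP[e1 e1'] /andP[e2 e2'].
rewrite -/k in up dn g1 g2.
have t4 : e = t + t + t + t by rewrite /t; field.
rewrite {}t4 in m1 m2 *; move: up dn far rt few Kt e1 e1' e2 e2' g1 g2 m1 m2.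
exact: cdf_bounds.
Unshelve. all: by end_near. Qed.

End Convergence.

(** * Transfer to random colorings on arbitrary probability spaces *)

Theorem theorem2p11 (R : realType) (c r : nat) (hc : (2 <= c)%N) (hr : (3 <= r)%N)
    (a : {ffun 'I_r -> 'I_c.-1}) (theta : 'I_c.-1 -> R)
    (theta_gt0 : forall b, 0 < theta b)
    (hsum : weighted_theta theta a < 2)
    (hmax : theta_max theta a = 1)
    (* the random colorings phi n of [n], for n large *)
    (d : nat -> measure_display) (T : forall n, measurableType (d n))
    (P : forall n, probability (T n) R)
    (phi : forall n, T n -> {ffun 'I_n -> 'I_c})
    (hphi : \forall n \near \oo, random_coloring (P n) theta (phi n))
    (* the Poisson point process *)
    (d' : measure_display) (Omega : measurableType d') (Q : probability Omega R)
    (PP : Omega -> set R)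
    (hPP : poisson_point_process Q 1 `[0, 1] PP) :
  cvg_in_distribution P
    (fun n w => (num_colorful_AP (phi n w) (palette_of a))%:R
                / n%:R `^ (2 - weighted_theta theta a))
    Q
    (fun w => \sum_(x \in PP w) lambda r (rare_coordinate theta a) x).
Proof.
have [s0 [-> s0P]] := rare_coordinateP theta_gt0 hsum hmax.
have th1 : theta (a s0) = 1 by apply/s0P.
have r_gt1 : (1 < r)%N by exact: ltnW.
have lip x y : `|lambda r s0.+1 x - lambda r s0.+1 y| <= `|x - y| :> R.
  by apply: lambda_lipschitz => //; rewrite ltn_ord.
split.
- apply: filterS hphi => n phiP _ Y mY; rewrite setTI.
  (* Any event depending on the coloring only is a finite union of measurable sets; the boolean
     reflection puts [Y] in the form of a predicate on colorings. *)
  rewrite [X in measurable X](_ : _ = [set w | `[< Y ((num_colorful_AP (phi n w)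
    (palette_of a))%:R / n%:R `^ (2 - weighted_theta theta a)) >]]).
    exact: (measurable_coloring_event phiP (fun f => `[< Y
      ((num_colorful_AP f (palette_of a))%:R / _) >])).
  by apply/seteqP; split=> w /= => [/asboolP|/asboolP].
- exact: (measurable_sum_points hPP lip).
move=> y cF.
have p_prob : \forall n \near \oo,
    (forall j, 0 <= color_prob theta n j) /\ \sum_j color_prob theta n j = 1.
  near=> n.
  have n0 : (0 < n)%N by near: n; exact: nbhs_infty_gt.
  have phiP : random_coloring (P n) theta (phi n) by near: n.
  split=> [j|]; first exact: color_prob_ge0 phiP _ n0.
  exact: color_prob_sum1 phiP n0.
have cvgF := cvg_colorful_cdf hr hsum th1 p_prob hPP cF.
have -> : Q [set w | \sum_(x \in PP w) lambda r s0.+1 x <= y] =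
    (point_cdf Q PP (lambda r s0.+1) y)%:E.
  rewrite fineK // fin_num_measure //.
  exact: (measurable_point_sum_le hPP lip).
(* The law of [phi n] is known only for large [n], so the two sequences agree only eventually. *)
have lawE : \forall n \near \oo, P n [set w | (num_colorful_AP (phi n w)
      (palette_of a))%:R / n%:R `^ (2 - weighted_theta theta a) <= y] =
    (expect (color_prob theta n) (fun f : {ffun 'I_n -> 'I_c} =>
      ((num_colorful_AP f (palette_of a))%:R /
       n%:R `^ (2 - weighted_theta theta a) <= y)%R%:R))%:E.
  apply: filterS hphi => n phiP.
  exact: (coloring_law phiP (fun f => _ <= y)).
apply: cvg_EFin; first by apply: filterS lawE => n ->.
apply: cvg_trans cvgF; apply: near_eq_cvg.
by apply: filterS lawE => n /= ->.
Unshelve. all: by end_near. Qed.
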